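(* Let $n$ be an integer and $\Gamma=\mathrm{BS}(1,n)=\langle a,b\mid bab^{-1}=a^n\rangle$. Then $\Gamma$ has exponential growth (so in particular is not virtually nilpotent) for $n\ge3$, and $\operatorname{asdim}\Box_{(N_i)}\Gamma=\operatorname{asdim}\Gamma=2$ for any sequence $(N_i)_{i\in\mathbb N}$ of normal subgroups of $\Gamma$, with $N_{i+1}\subset N_i$ for all $i$, which is a filtration of $\Gamma$.
   Context: A filtration of $\Gamma$ is a collection $\{N_i\}$ of finite index subgroups with $\bigcap_iN_i=\{e\}$. Asymptotic dimension: for a metric space $X$, an $r$-chain in $U\subset X$ is a finite sequence $x_0,\dots,x_k\in U$ with $d(x_i,x_{i+1})\le r$ for all $i$; $r$-components of $U$ are the classes of points of $U$ connected by $r$-chains in $U$. $\operatorname{asdim}X\le d$ means that for all $r>0$ there are $M>0$ and a cover $\{U_0,\dots,U_d\}$ of $X$ such that every $r$-component of every $U_j$ has diameter at most $M$. $\operatorname{asdim}X$ is the least such integer $d\ge0$ ($\infty$ if none). $\Gamma$ carries a fixed right-invariant proper metric $d_\Gamma$ (balls are finite; unique up to coarse equivalence, e.g. the word metric of a finite generating set), and $\operatorname{asdim}\Gamma$ is taken with respect to it. $\Gamma/N_i$ has the metric in which the distance between two cosets is the infimum of the $d_\Gamma$-distances between their elements. The box space $\Box_{(N_i)}\Gamma$ is the disjoint union of the $\Gamma/N_i$ with $d(x,y)=d_{\Gamma/N_i}(x,y)$ if $x,y\in\Gamma/N_i$ and $d(x,y)=\operatorname{diam}(\Gamma/N_i)+\operatorname{diam}(\Gamma/N_j)$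 if $x\in\Gamma/N_i$, $y\in\Gamma/N_j$, $i\ne j$.
   Formalization: The integer n is assumed nonzero: for n = 0 the relation forces a = e, so Γ is infinite cyclic with asymptotic dimension 1 and the claimed value 2 is false. *)

(* Defs.v *)
From HB Require Import structures.
From mathcomp Require Import all_boot all_order all_algebra.
From mathcomp Require Import finmap generic_quotient.
From mathcomp Require Import boolp classical_sets functions cardinality reals ereal.
Set Implicit Arguments.
Unset Strict Implicit.
Unset Printing Implicit Defensive.
Import Order.TTheory GRing.Theory Num.Theory.
Local Open Scope classical_set_scope.
Local Open Scope quotient_scope.
Local Open Scope group_scope.

(** * Groups given by generators and relations *)

(* The letter (x, e) stands for the generator x if e = false and for its
   inverse if e = true; a relation u = v is the pair (u, v). *)
Definition letter (X : choiceType) : choiceType := (X * bool)%type.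
Definition word (X : choiceType) : choiceType := seq (letter X).

Definition inv_letter (X : choiceType) (l : letter X) : letter X :=
  (l.1, ~~ l.2).
Definition inv_word (X : choiceType) (w : word X) : word X :=
  rev (map (@inv_letter X) w).
Definition letter_exp (X : choiceType) (x : X) (n : int) : word X :=
  match n with
  | Posz k => nseq k (x, false)
  | Negz k => nseq k.+1 (x, true)
  end.

Inductive pres_eq (X : choiceType) (rels : set (word X * word X)) :
    word X -> word X -> Prop :=
| pres_refl w : pres_eq rels w w
| pres_sym w1 w2 : pres_eq rels w1 w2 -> pres_eq rels w2 w1
| pres_trans w2 w1 w3 :
    pres_eq rels w1 w2 -> pres_eq rels w2 w3 -> pres_eq rels w1 w3
| pres_cancel u l v : pres_eq rels (u ++ [:: l; inv_letter l] ++ v) (u ++ v)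
| pres_rel u r v : rels r -> pres_eq rels (u ++ r.1 ++ v) (u ++ r.2 ++ v).

Lemma inv_letterK (X : choiceType) : involutive (@inv_letter X).
Proof. by case=> x e; rewrite /inv_letter /= negbK. Qed.

Lemma pres_eq_ctx (X : choiceType) (rels : set (word X * word X)) u v w1 w2 :
  pres_eq rels w1 w2 -> pres_eq rels (u ++ w1 ++ v) (u ++ w2 ++ v).
Proof.
elim=> [w|w w' _ IH|w' w w'' _ IH _ IH'|u' l v'|u' r v' r_rel].
- exact: pres_refl.
- exact: pres_sym.
- exact: pres_trans IH IH'.
- by have := pres_cancel rels (u ++ u') l (v' ++ v); rewrite -!catA.
- by have := pres_rel (u ++ u') (v' ++ v) r_rel; rewrite -!catA.
Qed.

Lemma pres_eq_cat (X : choiceType) (rels : set (word X * word X)) u u' v v' :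
  pres_eq rels u u' -> pres_eq rels v v' -> pres_eq rels (u ++ v) (u' ++ v').
Proof.
move=> eu ev; apply: (@pres_trans _ _ (u' ++ v)).
  exact: (pres_eq_ctx [::] v eu).
by have := pres_eq_ctx u' [::] ev; rewrite !cats0.
Qed.

Lemma pres_eq_mulwV (X : choiceType) (rels : set (word X * word X)) w :
  pres_eq rels (w ++ inv_word w) [::].
Proof.
elim/last_ind: w => [|w l IH]; first exact: pres_refl.
apply: pres_trans IH.
rewrite /inv_word map_rcons rev_rcons cat_rcons.
exact: pres_cancel.
Qed.

Lemma inv_wordK (X : choiceType) : involutive (@inv_word X).
Proof.
move=> w; rewrite /inv_word map_rev revK -map_comp map_id_in // => l _.
exact: inv_letterK.
Qed.

Lemma pres_eq_mulVw (X : choiceType) (rels : set (word X * word X)) w :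
  pres_eq rels (inv_word w ++ w) [::].
Proof. by have := pres_eq_mulwV rels (inv_word w); rewrite inv_wordK. Qed.

Lemma pres_eq_inv (X : choiceType) (rels : set (word X * word X)) u v :
  pres_eq rels u v -> pres_eq rels (inv_word u) (inv_word v).
Proof.
move=> euv; apply: (@pres_trans _ _ (inv_word u ++ (v ++ inv_word v))).
  rewrite -[X in pres_eq _ X _]cats0; apply: pres_eq_cat (pres_refl _ _) _.
  exact/pres_sym/pres_eq_mulwV.
rewrite catA -[X in pres_eq _ _ X]cat0s.
apply: pres_eq_cat (pres_refl _ _).
apply: pres_trans (pres_eq_mulVw rels u).
exact: pres_eq_cat (pres_refl _ _) (pres_sym euv).
Qed.

Definition pres_rel_bool (X : choiceType) (rels : set (word X * word X)) :
  rel (word X) := fun u v => `[< pres_eq rels u v >].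

Lemma pres_equiv_class (X : choiceType) (rels : set (word X * word X)) :
  equiv_class_of (pres_rel_bool rels).
Proof.
split=> [w|u v|v u w].
- exact/asboolP/pres_refl.
- by apply/asboolP/asboolP => /pres_sym.
- by move=> /asboolP uv /asboolP vw; apply/asboolP/(pres_trans uv vw).
Qed.

Canonical pres_equiv (X : choiceType) (rels : set (word X * word X)) :=
  EquivRelPack (pres_equiv_class rels).

Definition presented (X : choiceType) (rels : set (word X * word X)) : Type :=
  {eq_quot pres_equiv rels}.

HB.instance Definition _ (X : choiceType) (rels : set (word X * word X)) :=
  Choice.on (presented rels).
HB.instance Definition _ (X : choiceType) (rels : set (word X * word X)) :=
  EqQuotient.on (presented rels).

Definition pres_class (X : choiceType) (rels : set (word X * word X))
  (w : word X) : presented rels := \pi_(presented rels) w.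

Lemma pres_classP (X : choiceType) (rels : set (word X * word X)) u v :
  pres_class rels u = pres_class rels v <-> pres_eq rels u v.
Proof.
rewrite /pres_class; split=> [/eqP|uv].
  by rewrite (@pi_eq_quot _ _ (presented rels)) => /asboolP.
by apply/eqP; rewrite (@pi_eq_quot _ _ (presented rels)); apply/asboolP.
Qed.

Definition pres_one (X : choiceType) (rels : set (word X * word X)) :=
  pres_class rels [::].
Definition pres_mul (X : choiceType) (rels : set (word X * word X))
  (g h : presented rels) := pres_class rels (repr g ++ repr h).
Definition pres_inv (X : choiceType) (rels : set (word X * word X))
  (g : presented rels) := pres_class rels (inv_word (repr g)).

Lemma pres_reprK (X : choiceType) (rels : set (word X * word X))
  (g : presented rels) : pres_class rels (repr g) = g.
Proof. exact: reprK. Qed.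

Lemma pres_repr_class (X : choiceType) (rels : set (word X * word X)) w :
  pres_eq rels (repr (pres_class rels w)) w.
Proof. by apply/pres_classP; rewrite pres_reprK. Qed.

Lemma pres_mulE (X : choiceType) (rels : set (word X * word X)) u v :
  pres_mul (pres_class rels u) (pres_class rels v) = pres_class rels (u ++ v).
Proof. by apply/pres_classP; apply: pres_eq_cat; exact: pres_repr_class. Qed.

Lemma pres_invE (X : choiceType) (rels : set (word X * word X)) u :
  pres_inv (pres_class rels u) = pres_class rels (inv_word u).
Proof. by apply/pres_classP; apply: pres_eq_inv; exact: pres_repr_class. Qed.

Lemma pres_mulA (X : choiceType) (rels : set (word X * word X)) :
  associative (@pres_mul X rels).
Proof.
by move=> x y z; rewrite -[x]pres_reprK -[y]pres_reprK -[z]pres_reprK !pres_mulE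
  catA.
Qed.

Lemma pres_mul1g (X : choiceType) (rels : set (word X * word X)) :
  left_id (pres_one rels) (@pres_mul X rels).
Proof. by move=> x; rewrite -[x]pres_reprK pres_mulE. Qed.

Lemma pres_mulg1 (X : choiceType) (rels : set (word X * word X)) :
  right_id (pres_one rels) (@pres_mul X rels).
Proof. by move=> x; rewrite -[x]pres_reprK pres_mulE cats0. Qed.

Lemma pres_mulVg (X : choiceType) (rels : set (word X * word X)) :
  left_inverse (pres_one rels) (@pres_inv X rels) (@pres_mul X rels).
Proof.
move=> x; rewrite -[x]pres_reprK pres_invE pres_mulE.
exact/pres_classP/pres_eq_mulVw.
Qed.

Lemma pres_mulgV (X : choiceType) (rels : set (word X * word X)) :
  right_inverse (pres_one rels) (@pres_inv X rels) (@pres_mul X rels).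
Proof.
move=> x; rewrite -[x]pres_reprK pres_invE pres_mulE.
exact/pres_classP/pres_eq_mulwV.
Qed.

HB.instance Definition _ (X : choiceType) (rels : set (word X * word X)) :=
  isGroup.Build (presented rels) (@pres_mulA X rels) (@pres_mul1g X rels)
    (@pres_mulg1 X rels) (@pres_mulVg X rels) (@pres_mulgV X rels).

(* The generators a and b are the letters false and true respectively. *)
Definition BS1_rels (n : int) : set (word bool * word bool) :=
  [set (letter_exp true 1 ++ letter_exp false 1 ++ letter_exp true (-1),
        letter_exp false n)].

Definition BS1 (n : int) : groupType := presented (BS1_rels n).

(** * Subgroups, finite index, nilpotency *)

Definition is_subgroup (G : groupType) (H : set G) : Prop :=
  H 1 /\ forall x y, H x -> H y -> H (x / y).

Definition is_normal_subgroup (G : groupType) (H : set G) : Prop :=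
  is_subgroup H /\ forall x y, H x -> H (x ^ y).

Definition left_coset (G : groupType) (H : set G) (x : G) : set G :=
  [set x * h | h in H].

Definition cosets (G : groupType) (H : set G) : set (set G) :=
  range (left_coset H).

Definition finite_index (G : groupType) (H : set G) : Prop :=
  finite_set (cosets H).

Definition is_filtration (G : groupType) (I : Type) (N : I -> set G) : Prop :=
  (forall i, is_subgroup (N i) /\ finite_index (N i)) /\
  \bigcap_i N i = [set 1].

Definition lower_central_series (G : groupType) (H : set G) : nat -> set G :=
  fix gamma k :=
    if k is k'.+1 then
      smallest (@is_subgroup G)
        [set z | exists x y, [/\ gamma k' x, H y & z = [~ x, y]]]
    else H.

Definition is_nilpotent (G : groupType) (H : set G) : Prop :=
  exists k, lower_central_series H k = [set 1].

Definition virtually_nilpotent (G : groupType) : Prop :=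
  exists H : set G, [/\ is_subgroup H, finite_index H & is_nilpotent H].

(** * Growth *)

Definition word_ball (G : groupType) (S : set G) (k : nat) : set G :=
  [set x | exists s : seq G,
    [/\ (size s <= k)%N, forall y, y \in s -> S y \/ S y^-1
      & x = \prod_(y <- s) y]].

Definition finite_generating_set (G : groupType) (S : set G) : Prop :=
  finite_set S /\ \bigcup_k word_ball S k = [set: G].

(* Exponential growth is a property of finitely generated groups which does not
   depend on the finite generating set; it is required here for all of them. *)
Definition exponential_growth (R : realType) (G : groupType) : Prop :=
  (exists S : set G, finite_generating_set S) /\
  forall S : set G, finite_generating_set S ->
    exists c : R, (1 < c)%R /\
      forall k, (c ^+ k <= (#|` fset_set (word_ball S k)|)%:R)%R.

(** * Asymptotic dimension *)

Definition chain_connected (R : realType) (T : Type) (d : T -> T -> R) (r : R)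
    (U : set T) (x y : T) : Prop :=
  exists (k : nat) (c : nat -> T),
    [/\ c 0%N = x, c k = y, forall i, (i <= k)%N -> U (c i)
      & forall i, (i < k)%N -> (d (c i) (c i.+1) <= r)%R].

Definition asdim_le (R : realType) (T : Type) (d : T -> T -> R) (k : nat) :
    Prop :=
  forall r : R, (0 < r)%R ->
    exists M : R, (0 < M)%R /\
    exists U : 'I_k.+1 -> set T,
      \bigcup_j U j = [set: T] /\
      forall j x y, chain_connected d r (U j) x y -> (d x y <= M)%R.

(* The infimum is +oo if asdim_le never holds, and the least k such that
   asdim_le d k otherwise. *)
Definition asdim (R : realType) (T : Type) (d : T -> T -> R) : \bar R :=
  ereal_inf [set (k%:R)%:E | k in asdim_le d].

(** * Box spaces *)

Definition is_metric (R : realType) (T : Type) (d : T -> T -> R) : Prop :=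
  [/\ forall x y, d x y = 0%R <-> x = y,
      forall x y, d x y = d y x
    & forall x y z, (d x z <= d x y + d y z)%R].

Definition proper_right_invariant_metric (R : realType) (G : groupType)
    (d : G -> G -> R) : Prop :=
  [/\ is_metric d, forall x y g, d (x * g) (y * g) = d x y
    & forall x r, finite_set [set y | (d x y <= r)%R]].

Definition set_dist (R : realType) (T : Type) (d : T -> T -> R)
    (A B : set T) : R :=
  inf [set r | exists x y, [/\ A x, B y & r = d x y]].

(* The type cosets H of cosets of H is G / H. *)
Definition coset_dist (R : realType) (G : groupType) (d : G -> G -> R)
    (H : set G) (A B : cosets H) : R :=
  set_dist d (val A) (val B).

(* To be used for bounded d only: sup is a junk value otherwise. *)
Definition diameter (R : realType) (T : Type) (d : T -> T -> R) : R :=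
  sup [set r | exists x y, r = d x y].

Definition box_space (G : groupType) (N : nat -> set G) : Type :=
  {i : nat & cosets (N i)}.

(* set_dist is coset_dist when p and q have the same index. *)
Definition box_dist (R : realType) (G : groupType) (d : G -> G -> R)
    (N : nat -> set G) (p q : box_space N) : R :=
  if tag p == tag q then set_dist d (val (tagged p)) (val (tagged q))
  else (diameter (coset_dist d (H := N (tag p))) +
        diameter (coset_dist d (H := N (tag q))))%R.

(* Main.v *)
(* The element b ^ t * a ^ x (x in Z[1/n]) has coordinates (t, x), and moving a
   bounded amount in Gamma changes t boundedly and x by a bounded multiple of
   n ^ - (t + c).  For the upper bound, cut Gamma into slabs along a separated
   net of levels t, and cut each slab along walls, i.e. a separated net in the x
   coordinate at the scale of that slab.  Faces, edges and vertices of the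
   resulting brick pattern give three families with bounded components.  Both
   nets are maximal separated sets modulo N, so the pattern is N-invariant and
   descends to Gamma / N with bounds independent of N as soon as N avoids some
   finite set.  For n = 1 the group is Z ^ 2, and the same pattern is used in
   coordinates across and along a shortest vector of N.

   For the lower bound, a large rectangle in a hyperbolic sheet of Gamma has
   opposite sides far apart at every level; by the Hex theorem two sets covering
   it have a long chain.  Deep quotients contain isometric copies of the
   rectangle, so this applies to the box space as well. *)

Require Import Defs.
From mathcomp Require Import all_boot all_order all_algebra.
From mathcomp Require Import finmap zify ring lra.
From mathcomp Require Import boolp classical_sets functions cardinality reals ereal.
Set Implicit Arguments.
Unset Strict Implicit.
Unset Printing Implicit Defensive.
Import Order.TTheory GRing.Theory Num.Theory.

(** * Coordinates on BS(1,n) *)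

(** Inside a slab, bounded steps change [x] by bounded integer multiples of a single mesh, so a
    chain stays in one coset of an infinite cyclic group. The branching of Gamma disappears there,
    and every estimate concerns integer walks with bounded steps.

    The obstacle is uniformity in N. An element of N outside a large finite set may still have a
    small non-zero level t, its [x] being huge, and this would rule out an N-invariant separated net
    of levels. If n ^ t differs from 1, the commutator with [a] is the translation by 1 - n ^ (- t),
    non-zero and independent of [x]; conjugating by a power of [b] makes it an integer translation
    of bounded size, which a finite set excludes. For n = -1 and t even, the product of the element
    with its conjugate by [b] is used instead. For n = 1 nothing of the kind exists: a lattice in Z
    ^ 2 may contain (1, y) with y huge. Hence coordinates adapted to N; they are scaled by the
    length of the shortest vector, and returning to the original coordinates divides this scale
    out. *)

Section Coordinates.
Local Open Scope ring_scope.
Variables (n : int) (n_neq0 : n != 0).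
Local Notation nQ := (n%:~R : rat).
Local Notation G := (BS1 n).

Lemma nQ_neq0 : nQ != 0.
Proof. by rewrite intr_eq0. Qed.
#[local] Hint Resolve nQ_neq0 : core.

Lemma nQD (s t : int) : nQ ^ (s + t) = nQ ^ s * nQ ^ t.
Proof. exact: expfzDr. Qed.

(* The element [b ^ t * a ^ x] of the affine group has coordinates [(t, x)];
   the letters act on coordinates by left multiplication. *)
Definition letter_act (l : letter bool) (z : int * rat) : int * rat :=
  let e : int := if l.2 then -1 else 1 in
  if l.1 then (z.1 + e, z.2) else (z.1, z.2 + e%:~R * nQ ^ (- z.1)).

Definition word_act (w : word bool) (z : int * rat) : int * rat :=
  foldr letter_act z w.

Lemma word_act_cat u v z : word_act (u ++ v) z = word_act u (word_act v z).
Proof. by rewrite /word_act foldr_cat. Qed.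

Lemma word_act_aexp (k : int) z :
  word_act (letter_exp false k) z = (z.1, z.2 + k%:~R * nQ ^ (- z.1)).
Proof.
have pos m (e : bool) : word_act (nseq m (false, e)) z =
    (z.1, z.2 + (if e then - m%:Z else m%:Z)%:~R * nQ ^ (- z.1)).
  elim: m => [|m IH] /=; first by case: z e => ? ? [] /=; rewrite ?oppr0 mul0r addr0.
  rewrite IH /letter_act /=; case: e {IH} => /=; congr pair; rewrite ?intS ?opprD ?intrD; ring.
by case: k => m; rewrite /letter_exp pos // NegzE.
Qed.

Lemma pres_eq_act u v : pres_eq (BS1_rels n) u v -> word_act u =1 word_act v.
Proof.
elim=> {u v} [|u v _ IH z|v u w _ IH1 _ IH2 z|u [x e] v z|u r v].
- by [].
- by rewrite IH.
- by rewrite IH1 IH2.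
- rewrite !word_act_cat; congr word_act.
  case: (word_act v z) => t y; rewrite /letter_act /= /letter_act /=.
  by case: x; case: e => /=; rewrite ?mulN1r ?mul1r ?addrK ?subrK.
- rewrite /BS1_rels /= => -> z; rewrite !word_act_cat; congr word_act.
  move: (word_act v z) => {u v z} [t y] /=.
  rewrite word_act_aexp /letter_act /= subrK; congr pair.
  by rewrite opprB nQD expr1z mul1r.
Qed.

Definition tc (g : G) : int := (word_act (repr g) (0, 0)).1.
Definition xc (g : G) : rat := (word_act (repr g) (0, 0)).2.

(** Left multiplication commutes with right translation, so the action on the origin determines the
    whole action; this is the source of the product formulas [tcM] and [xcM]. *)
Lemma word_act_coord w z :
  word_act w z = (z.1 + (word_act w (0, 0)).1,
                  z.2 + nQ ^ (- z.1) * (word_act w (0, 0)).2).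
Proof.
elim: w => [|[x e] w IH]; first by case: z => ? ?; rewrite /= mulr0 !addr0.
have E z' : word_act ((x, e) :: w) z' = letter_act (x, e) (word_act w z') by [].
rewrite !E IH; case: (word_act w (0, 0)) => t y; rewrite /letter_act /=.
case: x {E} => /=; first by rewrite addrA.
by rewrite opprD nQD mulrDr addrA mulrCA.
Qed.

Lemma tc_class w : tc (pres_class _ w) = (word_act w (0, 0)).1.
Proof. by rewrite /tc (pres_eq_act (pres_repr_class _ _)). Qed.

Lemma xc_class w : xc (pres_class _ w) = (word_act w (0, 0)).2.
Proof. by rewrite /xc (pres_eq_act (pres_repr_class _ _)). Qed.

Lemma tcM (g h : G) : tc (g * h)%g = tc g + tc h.
Proof. by rewrite /tc (pres_eq_act (pres_repr_class _ _)) word_act_cat word_act_coord addrC. Qed.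

Lemma xcM (g h : G) : xc (g * h)%g = xc h + nQ ^ (- tc h) * xc g.
Proof. by rewrite /xc (pres_eq_act (pres_repr_class _ _)) word_act_cat word_act_coord. Qed.

Lemma tc1 : tc (1%g : G) = 0.
Proof. by rewrite tc_class. Qed.

Lemma xc1 : xc (1%g : G) = 0.
Proof. by rewrite xc_class. Qed.

Lemma tcV (g : G) : tc (g^-1)%g = - tc g.
Proof. by apply/eqP; rewrite -subr_eq0 opprK -tcM mulVg tc1. Qed.

Lemma xcV (g : G) : xc (g^-1)%g = - (nQ ^ (tc g) * xc g).
Proof.
have := xcM g (g^-1)%g; rewrite mulgV xc1 tcV opprK => /esym/eqP.
by rewrite addr_eq0 => /eqP.
Qed.

(** * Generators, normal form and faithfulness of the coordinates *)

Definition gen_a : G := pres_class _ [:: (false, false)].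
Definition gen_b : G := pres_class _ [:: (true, false)].

Lemma tc_a : tc gen_a = 0. Proof. by rewrite tc_class. Qed.
Lemma xc_a : xc gen_a = 1. Proof. by rewrite xc_class. Qed.
Lemma tc_b : tc gen_b = 1. Proof. by rewrite tc_class. Qed.
Lemma xc_b : xc gen_b = 0. Proof. by rewrite xc_class. Qed.

Lemma coord_aX k : tc (gen_a ^+ k)%g = 0 /\ xc (gen_a ^+ k)%g = k%:R.
Proof.
elim: k => [|k [IH1 IH2]]; first by rewrite expg0 tc1 xc1.
by rewrite expgS tcM xcM IH1 IH2 tc_a xc_a addr0 oppr0 expr0z mul1r natr1.
Qed.

Lemma coord_bX k : tc (gen_b ^+ k)%g = k%:Z /\ xc (gen_b ^+ k)%g = 0.
Proof.
elim: k => [|k [IH1 IH2]]; first by rewrite expg0 tc1 xc1.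
by rewrite expgS tcM xcM IH1 IH2 tc_b xc_b mulr0 addr0 -intS.
Qed.

Lemma classM u v : (pres_class (BS1_rels n) u * pres_class _ v)%g = pres_class _ (u ++ v).
Proof. exact: pres_mulE. Qed.

Lemma class_cons l w : pres_class (BS1_rels n) (l :: w) =
  (pres_class _ [:: l] * pres_class _ w)%g.
Proof. by rewrite classM. Qed.

Lemma class_a_inv : pres_class _ [:: (false, true)] = (gen_a^-1)%g.
Proof. exact/esym/(pres_invE (BS1_rels n) [:: (false, false)]). Qed.

Lemma class_b_inv : pres_class _ [:: (true, true)] = (gen_b^-1)%g.
Proof. exact/esym/(pres_invE (BS1_rels n) [:: (true, false)]). Qed.

Definition apow (k : int) : G :=
  match k with Posz m => (gen_a ^+ m)%g | Negz m => (gen_a ^- m.+1)%g end.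

Lemma apowE k : apow k = pres_class _ (letter_exp false k).
Proof.
have E m (e : bool) : pres_class (BS1_rels n) (nseq m (false, e)) =
    (pres_class _ [:: (false, e)] ^+ m)%g.
  by elim: m => [|m IH] //=; rewrite class_cons IH expgS.
by case: k => m; rewrite /apow /letter_exp E // class_a_inv expVgn.
Qed.

Lemma apowS k : apow (k + 1) = (gen_a * apow k)%g.
Proof.
case: k => [m|[|m]].
- have -> : Posz m + 1 = Posz m.+1 by lia.
  by rewrite /= expgS.
- by rewrite /= mulgV.
- have -> : Negz m.+1 + 1 = Negz m by lia.
  by rewrite /= [in RHS]expgSr invgM mulVKg.
Qed.

Lemma apowP k : apow (k - 1) = (gen_a^-1 * apow k)%g.
Proof. by rewrite -{2}[k](subrK 1) apowS mulKg. Qed.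

Lemma apow0 : apow 0 = 1%g. Proof. by []. Qed.

Lemma apowD j k : apow (j + k) = (apow j * apow k)%g.
Proof.
elim/int_rect: j => [|m IH|m IH]; first by rewrite add0r apow0 mul1g.
- have -> : m.+1%:Z = m%:Z + 1 by lia.
  by rewrite addrAC !apowS IH mulgA.
- have -> : - m.+1%:Z = - m%:Z - 1 by lia.
  by rewrite addrAC !apowP IH mulgA.
Qed.

Lemma bapow k : (gen_b * apow k)%g = (apow (n * k) * gen_b)%g.
Proof.
have ba : (gen_b * gen_a = apow n * gen_b)%g.
  apply: (canRL (mulgVK _)); rewrite apowE -class_b_inv.
  rewrite /gen_b /gen_a (classM [:: (true, false)] [:: (false, false)]) (classM [:: _; _]).
  by apply/pres_classP; have := @pres_rel _ (BS1_rels n) [::] _ [::] (erefl _); rewrite /= cats0.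
have baV : (gen_b * gen_a^-1 = apow (- n) * gen_b)%g.
  by apply: (mulIg gen_a); rewrite mulgVK -!mulgA ba mulgA -apowD addNr apow0 mul1g.
elim/int_rect: k => [|m IH|m IH]; first by rewrite mulr0 apow0 mul1g mulg1.
- have -> : m.+1%:Z = m%:Z + 1 by lia.
  by rewrite apowS mulgA ba -mulgA IH mulgA -apowD mulrDr mulr1 addrC.
- have -> : - m.+1%:Z = - m%:Z - 1 by lia.
  by rewrite apowP mulgA baV -mulgA IH mulgA -apowD mulrBr mulr1 addrC.
Qed.

Lemma bXapow k j : (gen_b ^+ k * apow j)%g = (apow (n ^+ k * j) * gen_b ^+ k)%g.
Proof.
elim: k j => [|k IH] j; first by rewrite mul1g mulg1 mul1r.
by rewrite expgSr -mulgA bapow mulgA IH -mulgA -expgSr mulrA -exprSr.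
Qed.

(** This shape is stable under left multiplication by each letter: [b] cancels against [b ^- k] or
    passes [apow j] by multiplying [j] by [n], and [a] passes [b ^- k] by becoming
    [apow (n ^+ k)]. *)
Lemma BS1_normal_form (g : G) :
  exists (k l : nat) (j : int), g = (gen_b ^- k * apow j * gen_b ^+ l)%g.
Proof.
rewrite -[g]pres_reprK; elim: (repr g) => [|[x e] w [k [l [j IH]]]].
  by exists 0, 0, 0; rewrite invg1 !mul1g.
rewrite class_cons {}IH; case: x; case: e.
- exists k.+1, l, j; rewrite class_b_inv expgSr invgM -!mulgA //.
- case: k => [|k]; last first.
    exists k, l, j; rewrite expgSr invgM -/gen_b !mulgA mulgV mul1g //.
  exists 0, l.+1, (n * j); rewrite invg1 !mul1g mulgA -/gen_b bapow expgS !mulgA //.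
- exists k, l, (- n ^+ k + j); rewrite class_a_inv apowD !mulgA.
  congr (_ * _ * _)%g; apply: (mulgI (gen_b ^+ k)%g); rewrite !mulgA mulgV mul1g.
  have -> : (gen_a^-1 = apow (-1))%g by [].
  by rewrite bXapow mulrN1 mulgK.
- exists k, l, (n ^+ k + j); rewrite -/gen_a apowD !mulgA.
  congr (_ * _ * _)%g; apply: (mulgI (gen_b ^+ k)%g); rewrite !mulgA mulgV mul1g.
  have -> : (gen_a = apow 1)%g by [].
  by rewrite bXapow mulr1 mulgK.
Qed.

Lemma coord_apow j : tc (apow j) = 0 /\ xc (apow j) = j%:~R.
Proof.
case: j => m; rewrite /apow; first exact: coord_aX.
rewrite tcV xcV; have [-> ->] := coord_aX m.+1.
by rewrite expr0z mul1r oppr0 NegzE intrN.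
Qed.

Lemma coord_bVX k : tc (gen_b ^- k)%g = - k%:Z /\ xc (gen_b ^- k)%g = 0.
Proof. by rewrite tcV xcV; have [-> ->] := coord_bX k; rewrite mulr0 oppr0. Qed.

(** On a normal form, level 0 forces [l = k], and then [x] is [j] times a non-zero power of [n].
    Hence nothing is lost in passing from the presentation to the affine group. *)
Lemma coord_eq1 (g : G) : tc g = 0 -> xc g = 0 -> g = 1%g.
Proof.
have [k [l [j ->]]] := BS1_normal_form g; rewrite !tcM !xcM.
have [-> ->] := coord_bVX k; have [-> ->] := coord_bX l; have [-> ->] := coord_apow j.
rewrite mulr0 addr0 add0r addr0 => kl.
have {kl} -> : l = k by lia.
move=> /eqP; rewrite mulf_eq0 expfz_eq0 (negbTE nQ_neq0) andbF /= intr_eq0 => /eqP ->.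
by rewrite apow0 mulg1 mulVg.
Qed.

Lemma coord_inj (g h : G) : tc g = tc h -> xc g = xc h -> g = h.
Proof.
move=> et ex; apply: divg1_eq; apply: coord_eq1.
  by rewrite tcM tcV et subrr.
by rewrite xcM xcV tcV opprK ex addNr.
Qed.

Lemma xc_denom (g : G) : exists (k : nat) (j : int), xc g = j%:~R * nQ ^ (- k%:Z).
Proof.
have [k [l [j ->]]] := BS1_normal_form g; exists l, j; rewrite !xcM.
have [_ ->] := coord_bVX k; have [-> ->] := coord_bX l; have [-> ->] := coord_apow j.
by rewrite mulr0 addr0 add0r mulrC.
Qed.

End Coordinates.

(** * Finite boxes *)

Section Boxes.
Local Open Scope ring_scope.
Local Open Scope classical_set_scope.

Lemma finite_set_bound (R : realDomainType) (T : Type) (A : set T) (f : T -> R) :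
  finite_set A -> exists2 M, 0 < M & forall x, A x -> `|f x| <= M.
Proof.
move=> fA; have /finite_seqP[s sE] := finite_image f fA.
have {sE} sP x : A x -> f x \in s by move=> Ax; have : (f @` A) (f x) by [exists x]; rewrite sE.
suff [M M0 MP] : exists2 M, 0 < M & forall y, y \in s -> `|y| <= M.
  by exists M => // x /sP/MP.
elim: s {sP} => [|y s [M M0 IH]]; first by exists 1.
exists (M + `|y|) => [|z]; first by rewrite ltr_pwDl.
rewrite inE => /orP[/eqP ->|/IH]; first by rewrite lerDr ltW.
by move=> /le_trans; apply; rewrite lerDl.
Qed.

Variables (n : int) (n_neq0 : n != 0).
Local Notation nQ := (n%:~R : rat).
Local Notation G := (BS1 n).

(** Boxes replace metric balls: they are finite and every finite set lies in one, so for a proper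
    metric the two notions of boundedness agree. One parameter bounds both the level and the
    denominator of [x]. *)
Definition inbox (rho : nat) (P : int) (g : G) : Prop :=
  `|tc g| <= rho%:Z /\ exists2 k : int, `|k| <= P & xc g = k%:~R * nQ ^ (- rho%:Z).

Lemma finite_int_ball (P : int) : finite_set [set k : int | `|k| <= P].
Proof.
apply: (@sub_finite_set _ _ [set` [seq (i%:Z - (absz P)%:Z) | i <- iota 0 (absz P).*2.+1]]);
  last exact: finite_seq.
move=> k kP; rewrite /mkset in kP; rewrite /mkset; apply/mapP; exists (absz (k + (absz P)%:Z)); last by lia.
by rewrite mem_iota; lia.
Qed.

Lemma finite_inbox rho P : finite_set (inbox rho P).
Proof.
pose f (p : int * int) : int * rat := (p.1, p.2%:~R * nQ ^ (- rho%:Z)).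
pose B := [set k : int | `|k| <= rho%:Z] `*` [set k : int | `|k| <= P].
have fB : finite_set (f @` B).
  by apply: finite_image; apply: finite_setX; apply: finite_int_ball.
apply: (@sub_finite_set _ _ ((fun g : G => (tc g, xc g)) @^-1` (f @` B))).
  by move=> g [gt [k kP gx]]; exists (tc g, k) => //; rewrite /f /= gx.
by apply: finite_preimage fB => g h _ _ [] ; apply: coord_inj.
Qed.

Lemma inbox_le rho rho' P P' g : (rho <= rho')%N -> P * `|n| ^+ (rho' - rho) <= P' ->
  inbox rho P g -> inbox rho' P' g.
Proof.
move=> rr PP [gt [k kP gx]]; split; first by lia.
exists (k * n ^+ (rho' - rho)).
  by apply: le_trans PP; rewrite normrM normrX ler_wpM2r ?exprn_ge0.
rewrite gx intrM -mulrA; congr (_ * _).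
have -> : - rho%:Z = (rho' - rho)%N%:Z - rho'%:Z by lia.
by rewrite nQD // -[X in X * _]exprnP rmorphXn.
Qed.

Lemma finite_sub_inbox (A : set G) : finite_set A ->
  exists (rho : nat) (P : nat), [/\ (0 < rho)%N, (0 < P)%N & A `<=` inbox rho P%:Z].
Proof.
move=> fA.
have one (g : G) : exists (rP : nat * nat), inbox rP.1 rP.2%:Z g.
  have [k [j E]] := xc_denom n_neq0 g.
  exists ((absz (tc g) + k)%N, absz (j * n ^+ absz (tc g))); split => /=; first by lia.
  exists (j * n ^+ absz (tc g)); first by lia.
  rewrite E intrM -mulrA; congr (_ * _).
  have -> : - k%:Z = (absz (tc g))%:Z - (absz (tc g) + k)%N%:Z by lia.
  by rewrite nQD // -[X in X * _]exprnP rmorphXn.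
have [h hP] := choice one.
have [M M0 MP] := finite_set_bound (fun g => (h g).1%:Z) fA.
have [Q Q0 QP] := finite_set_bound (fun g => (h g).2%:Z) fA.
exists (absz M), (absz (Q * `|n| ^+ absz M)); split; first by lia.
  rewrite absz_gt0 mulf_neq0 //; first by lia.
  by rewrite expf_neq0 // normr_eq0.
move=> g Ag; apply: inbox_le (hP g).
  by have := MP g Ag; lia.
rewrite abszE [leRHS]ger0_norm; last by rewrite mulr_ge0 ?exprn_ge0 // ltW.
have := QP g Ag; rewrite ger0_norm // => gQ.
apply: ler_pM; rewrite ?exprn_ge0 //.
by apply: ler_weXn2l; [lia | rewrite leq_subr].
Qed.

End Boxes.

(** * Chains of integers *)

Section IntegerChains.
Local Open Scope ring_scope.

(** By Zorn's lemma: a point unrelated to all of [W] could be added. The relations used below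
    already allow translation by N, which makes the maximal sets N-invariant. *)
Lemma max_independent (T : Type) (E : T -> T -> Prop) :
  (forall x, ~ E x x) -> (forall x y, E x y -> E y x) ->
  exists W : set T, (forall x y, W x -> W y -> ~ E x y) /\
    (forall x, W x \/ exists2 y, W y & E y x).
Proof.
move=> Eirr Esym.
pose indep (W : set T) := forall x y, W x -> W y -> ~ E x y.
have [F Fi Ftot|W [iW maxW]] := @Zorn_bigcup T indep.
  move=> x y [A FA Ax] [A' FA' A'y].
  by have [sub|sub] := Ftot _ _ FA FA'; [apply: (Fi A' FA') | apply: (Fi A FA)] => //; apply: sub.
exists W; split=> // x; apply: contrapT => /not_orP[nWx nE].
apply: (maxW (W `|` [set x])%classic).
  by split=> [|/(_ x)]; [move=> y; left | move=> WW; apply: nWx; apply: WW; right].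
move=> y z [Wy|->] [Wz|->] Eyz.
- exact: iW Eyz.
- by apply: nE; exists y.
- by apply: nE; exists z => //; apply: Esym.
- exact: Eirr Eyz.
Qed.

Lemma chain_invariant (T : Type) (Q : T -> Prop) (f : nat -> T) (L : nat) :
  Q (f 0%N) -> (forall i, (i < L)%N -> Q (f i) -> Q (f i.+1)) ->
  forall i, (i <= L)%N -> Q (f i).
Proof.
move=> Q0 QS; elim=> [//|i IH] iL.
by apply: QS => //; apply: IH; apply: ltnW.
Qed.

Section Crossing.
Variables (k : nat -> int) (L : nat) (p : int).
Hypotheses (k0 : k 0%N = 0) (kS : forall i, (i < L)%N -> `|k i.+1 - k i| <= p).

(** A discrete intermediate value theorem: steps of size at most [p] cannot jump over [p]
    consecutive integers. *)
Lemma chain_crossing i v : (i <= L)%N -> 0 <= v -> v < k i ->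
  exists2 j, (j <= L)%N & v < k j <= v + p.
Proof.
move=> iL v0; elim: i iL => [|i IH] iL vk; first by lia.
have [vi|iv] := ltP v (k i); first exact: IH (ltnW iL) vi.
by exists i.+1 => //; have := kS iL; lia.
Qed.

Lemma chain_blocked (Q : int -> Prop) v :
  (forall i, (i <= L)%N -> ~ Q (k i)) -> 0 <= v ->
  (forall z, v < z <= v + p -> Q z) -> forall i, (i <= L)%N -> k i <= v.
Proof.
move=> nQ v0 vQ i iL; rewrite leNgt; apply/negP => vk.
by have [j jL /vQ] := chain_crossing iL v0 vk; apply: nQ.
Qed.

(* A chain leaving the window would meet three points pairwise more than [a]
   apart, two of them of the same kind. *)
Lemma chain_clustered (Q1 Q2 : int -> Prop) a b :
  0 < p -> 0 <= a -> 3 * p + 2 * a <= b ->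
  (forall i, (i <= L)%N -> Q1 (k i) \/ Q2 (k i)) ->
  (forall y z, Q1 y -> Q1 z -> `|y - z| <= b -> `|y - z| <= a) ->
  (forall y z, Q2 y -> Q2 z -> `|y - z| <= b -> `|y - z| <= a) ->
  forall i, (i <= L)%N -> k i <= b.
Proof.
move=> p0 a0 pab kQ cl1 cl2 i iL; rewrite leNgt; apply/negP => bk.
have hit v : 0 <= v -> v <= b -> exists2 j, (j <= L)%N & v < k j <= v + p.
  by move=> v0 vb; apply: (chain_crossing iL v0); lia.
have [||j1 jL1 h1] := hit 0; [lia|lia|].
have [||j2 jL2 h2] := hit (p + a); [lia|lia|].
have [||j3 jL3 h3] := hit (2 * p + 2 * a); [lia|lia|].
have [q1|q1] := kQ _ jL1; have [q2|q2] := kQ _ jL2; have [q3|q3] := kQ _ jL3.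
all: try (by have := cl1 _ _ q1 q2; lia).
all: try (by have := cl1 _ _ q1 q3; lia).
all: try (by have := cl1 _ _ q2 q3; lia).
all: try (by have := cl2 _ _ q1 q2; lia).
all: try (by have := cl2 _ _ q1 q3; lia).
all: try (by have := cl2 _ _ q2 q3; lia).
Qed.
End Crossing.

End IntegerChains.

(** * The brick pattern *)

Section Cover.
Local Open Scope ring_scope.
Variables (n : int) (n_neq0 : n != 0).
Local Notation nQ := (n%:~R : rat).
Variables (rho P : nat) (rho_gt0 : (0 < rho)%N) (P_gt0 : (0 < P)%N).

(* [(t, x)] stands for [b ^ t * a ^ x], and [rtrans] is right multiplication. *)
Definition rtrans (z g : int * rat) : int * rat :=
  (z.1 + g.1, nQ ^ (- g.1) * z.2 + g.2).

Definition adj (r : nat) (p : int) (z z' : int * rat) : Prop :=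
  `|z'.1 - z.1| <= r%:Z /\
  exists2 k : int, `|k| <= p & z'.2 = z.2 + k%:~R * nQ ^ (- (z.1 + r%:Z)).

(** Levels within [2 * rho] of two consecutive points of a chain are at most [5 * rho] apart, hence
    equal. *)
Definition level_gap : int := 6 * rho%:Z.
(** Near a level the mesh of the layer below is used: its base is at most [12 * rho] lower, the
    chain rises up to [2 * rho] above the level, and a step has [rho] more in its exponent. *)
Definition mesh_exp : nat := (15 * rho)%N.
(** The largest step of a chain, counted in units of the mesh. *)
Definition wall_width : int := P%:Z * `|n| ^+ mesh_exp.
(** A window of 7 widths, plus one width at each end, must stay below the gap even after refinement
    to the mesh of a layer based [12 * rho] higher. *)
Definition wall_gap : int := 9 * wall_width * `|n| ^+ (12 * rho) + 1.
Definition mesh (T : int) : rat := nQ ^ (- (T + mesh_exp%:Z)).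

Local Notation R := level_gap.
Local Notation p := wall_width.
Local Notation K := wall_gap.

Let nQn0 : nQ != 0 := nQ_neq0 n_neq0.

Lemma normn_ge1 : 1 <= `|n|.
Proof. by move: n_neq0; clear; lia. Qed.

Lemma wall_width_ge (m : nat) (k : int) :
  (m <= mesh_exp)%N -> `|k| <= P%:Z -> `|k * n ^+ m| <= p.
Proof.
move=> me kP; rewrite normrM normrX; apply: ler_pM; rewrite ?exprn_ge0 //.
by apply: ler_weXn2l => //; exact: normn_ge1.
Qed.

Lemma wall_width_gt0 : 0 < p.
Proof. by rewrite mulr_gt0 ?exprn_gt0 //; move: normn_ge1; lia. Qed.

Lemma wall_gap_gt (m : nat) : (m <= 12 * rho)%N -> 9 * p * `|n| ^+ m < K.
Proof.
move=> mr; rewrite ltzD1 ler_wpM2l //; first by move: wall_width_gt0; lia.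
by apply: ler_weXn2l => //; exact: normn_ge1.
Qed.

Lemma wall_gap_gt9 : 9 * p < K.
Proof. by have := @wall_gap_gt 0 isT; rewrite expr0 mulr1. Qed.

Lemma mesh_shift T s : nQ ^ (- s) * mesh T = mesh (T + s).
Proof. by rewrite /mesh -nQD //; congr (_ ^ _); lia. Qed.

Lemma mesh_exprn T (m : nat) : mesh T = (n ^+ m)%:~R * mesh (T + m%:Z).
Proof. by rewrite /mesh rmorphXn [X in X * _]exprnP -nQD //; congr (_ ^ _); lia. Qed.

Variable N : set (int * rat).
Hypotheses (N1 : N (0, 0)) (NM : forall g h, N g -> N h -> N (rtrans g h))
  (NV : forall g, N g -> N (- g.1, - (nQ ^ g.1 * g.2)))
  (N_level : forall g, N g -> `|g.1| < R -> g.1 = 0)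
  (N_wall : forall T (z : int), N (0, z%:~R * mesh T) -> `|z| < K -> z = 0).

Definition rinv (g : int * rat) : int * rat := (- g.1, - (nQ ^ g.1 * g.2)).

Lemma rtransA x g h : rtrans (rtrans x g) h = rtrans x (rtrans g h).
Proof.
rewrite /rtrans /= opprD nQD //; congr pair; first by rewrite addrA.
by rewrite mulrDr addrA mulrCA mulrA.
Qed.

Lemma rtransK g x : rtrans (rtrans x g) (rinv g) = x.
Proof.
case: x => t x; rewrite /rtrans /rinv /= addrK opprK; congr pair.
rewrite mulrDr mulrA -nQD // subrr expr0z mul1r addrK //.
Qed.

(** The relation compares levels up to displacements in N and is irreflexive by [N_level]. If a
    translate of a member of [B] were missing, it would be related to another member, and then so
    would the original one. *)
Lemma levels_exist : exists B : set int,
  [/\ forall T T', B T -> B T' -> `|T' - T| < R -> T = T',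
      forall t : int, exists2 T, B T & `|T - t| < R
    & forall T g, N g -> B T -> B (T + g.1)].
Proof.
have R0 : 0 < R by rewrite /level_gap; lia.
pose E T T' := exists2 g, N g & 0 < `|T' - T - g.1| < R.
have [||B [Bi Bd]] := @max_independent _ E.
- move=> T [g Ng /andP[g0 gR]].
  have := N_level Ng; lia.
- move=> T T' [g Ng gR]; exists (rinv g); first exact: NV.
  by rewrite /=; lia.
have BN T g : N g -> B T -> B (T + g.1).
  move=> Ng BT; have [//|[T' BT' [h Nh hR]]] := Bd (T + g.1).
  case: (Bi T' T BT' BT); exists (rtrans h (rinv g)); first by apply: NM => //; exact: NV.
  by rewrite /=; lia.
exists B; split=> // [T T' BT BT' TT'|t].
  apply: contrapT => TneT'; case: (Bi T T' BT BT'); exists (0, 0) => //=.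
  by apply/andP; split; lia.
have [Bt|[T BT [g Ng gR]]] := Bd t; first by exists t => //; lia.
by exists (T + g.1); [apply: BN | lia].
Qed.

(** The same argument as for levels. It applies because, by [mesh_shift], right translation rescales
    the mesh exactly as it rescales differences of [x]. *)
Lemma walls_exist : exists W : set (int * rat),
  [/\ forall T x (z : int), W (T, x) -> W (T, x + z%:~R * mesh T) -> `|z| < K -> z = 0,
      forall (T : int) (x : rat), exists2 z : int, `|z| < K & W (T, x + z%:~R * mesh T)
    & forall y g, N g -> W y -> W (rtrans y g)].
Proof.
have K0 : 0 < K by move: wall_gap_gt9 wall_width_gt0; lia.
pose E (y y' : int * rat) := exists g (z : int), [/\ N g, 0 < `|z| < K,
  y'.1 = y.1 + g.1 & y'.2 = (rtrans y g).2 + z%:~R * mesh y'.1].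
have [||W [Wi Wd]] := @max_independent _ E.
- move=> [T x] [[s c] [z [Ng zK /= Ts xE]]].
  have s0 : s = 0 by lia.
  move: xE Ng; rewrite {}s0 oppr0 expr0z mul1r => xE.
  have -> : c = (- z)%:~R * mesh T.
    by rewrite intrN mulNr; move/eqP: xE; rewrite -addrA -subr_eq0 opprD addNKr oppr_eq0 addr_eq0 => /eqP.
  by move=> /N_wall; lia.
- move=> [T x] [T' x'] [g [z [Ng zK /= Ts xE]]]; exists (rinv g), (- z).
  split; [exact: NV|by lia|by rewrite /= Ts addrK|].
  have -> : mesh T = nQ ^ g.1 * mesh T'.
    by rewrite Ts -[X in nQ ^ X]opprK mesh_shift addrK.
  have e : nQ ^ g.1 * nQ ^ (- g.1) = 1 by rewrite -nQD // subrr.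
  rewrite /= {}xE opprK /= !mulrDr mulrA e intrN.
  by move: (nQ ^ g.1) (mesh T') z%:~R => u v w; ring.
have WN y g : N g -> W y -> W (rtrans y g).
  move=> Ng Wy; have [//|[y' Wy' [h [z [Nh zK e1 e2]]]]] := Wd (rtrans y g).
  case: (Wi y' y Wy' Wy); exists (rtrans h (rinv g)), z; split=> //.
  - by apply: NM => //; exact: NV.
  - by move: e1; rewrite /=; lia.
  have -> : mesh y.1 = nQ ^ g.1 * mesh (rtrans y g).1.
    by rewrite -[X in nQ ^ X]opprK mesh_shift /= addrK.
  rewrite -rtransA -{1}[y](rtransK g) [in LHS]/rtrans e2 [in RHS]/rtrans /= opprK.
  by move: (nQ ^ g.1) (mesh _) z%:~R => u v w; ring.
exists W; split=> // [T x z Wx Wxz zK|T x].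
  apply: contrapT => z0; case: (Wi _ _ Wx Wxz); exists (0, 0), z; split=> //=.
  - by apply/andP; split; lia.
  - by rewrite addr0.
  - by rewrite oppr0 expr0z mul1r addr0.
have [Wx|[y Wy [g [z [Ng zK /= e1 e2]]]]] := Wd (T, x).
  by exists 0 => //; rewrite mul0r addr0.
exists (- z); first by lia.
have := WN y g Ng Wy; rewrite /rtrans -e1 => Wyg.
by rewrite intrN mulNr e2 addrK.
Qed.

(** In this range of levels the unit of every step is an integer multiple of [mesh T], by at most
    [mesh_exp] powers of [n]; the chain becomes an integer walk. *)
Lemma chain_on_line (T : int) (f : nat -> int * rat) (L : nat) :
  (forall i, (i <= L)%N -> T - rho%:Z <= (f i).1 /\ (f i).1 + rho%:Z <= T + mesh_exp%:Z) ->
  (forall i, (i < L)%N -> adj rho P%:Z (f i) (f i.+1)) ->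
  exists k : nat -> int, [/\ k 0%N = 0, forall i, (i < L)%N -> `|k i.+1 - k i| <= p
    & forall i, (i <= L)%N -> (f i).2 = (f 0%N).2 + (k i)%:~R * mesh T].
Proof.
move=> fT fadj.
have step i : exists k : int, (i < L)%N ->
    `|k| <= p /\ (f i.+1).2 = (f i).2 + k%:~R * mesh T.
  have [iL|] := boolP (i < L)%N; last by exists 0.
  have [_ [k kP kE]] := fadj i iL; have [lo hi] := fT i (ltnW iL).
  pose m := absz (T + mesh_exp%:Z - (f i).1 - rho%:Z)%R.
  exists (k * n ^+ m) => _; split; first by apply: wall_width_ge => //; lia.
  rewrite kE intrM -mulrA; congr (_ + _ * _).
  rewrite rmorphXn /mesh [X in X * _]exprnP -nQD //; congr (_ ^ _); lia.
have [kk kkP] := choice step.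
exists (fun i => \sum_(j < i) kk j); split=> [|i iL|i]; first by rewrite big_ord0.
  by rewrite big_ord_recr /= addrAC subrr add0r; case: (kkP i iL).
elim: i => [|i IH] iL; first by rewrite big_ord0 mul0r addr0.
by rewrite big_ord_recr /= intrD mulrDl addrA -IH 1?ltnW //; case: (kkP i iL).
Qed.

(** As [33 = 18 + 15], the mesh of [T] is an integer multiple of the target unit, by at most
    [36 * rho] powers of [n]. The exponent [63 = 15 + 12 + 36] collects width, gap and this change
    of unit; 30 absorbs [3 * 9] and the added 1 of the gap. *)
Lemma adj_conclude (T z t : int) (x : rat) (t' : int) (x' : rat) :
  `|t' - t| <= 33 * rho%:Z -> `|T - t| <= 18 * rho%:Z -> `|z| <= 3 * K ->
  x' = x + z%:~R * mesh T ->
  adj (33 * rho) (30 * P%:Z * `|n| ^+ (63 * rho)) (t, x) (t', x').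
Proof.
move=> tt' Tt zK ->; split => /=; first by rewrite PoszM.
pose m := absz (t + 18 * rho%:Z - T)%R.
have mr : (m <= 36 * rho)%N by rewrite /m; lia.
exists (z * n ^+ m).
  rewrite normrM normrX; apply: le_trans (_ : 3 * K * `|n| ^+ (36 * rho) <= _).
    apply: ler_pM; rewrite ?exprn_ge0 //.
    by apply: ler_weXn2l => //; exact: normn_ge1.
  rewrite /wall_gap /wall_width /mesh_exp.
  have -> : (63 * rho = 15 * rho + 12 * rho + 36 * rho)%N by lia.
  have q1 : 1 <= `|n| ^+ (15 * rho + 12 * rho) by apply: exprn_ege1; exact: normn_ge1.
  have P1 : 1 <= P%:Z by lia.
  rewrite exprD [leRHS]mulrA ler_wpM2r ?exprn_ge0 //; move: q1; rewrite exprD.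
  by move: (`|n| ^+ _) (`|n| ^+ _) => u v; nia.
rewrite intrM -mulrA; congr (_ + _ * _).
rewrite rmorphXn /mesh [X in X * _]exprnP -nQD //; congr (_ ^ _).
by rewrite /m /mesh_exp; lia.
Qed.

(** * Neighbourhoods of levels and walls, for fixed invariant nets *)

Section LevelsAndWalls.
Variables (B : set int) (W : set (int * rat)).
Hypotheses (B_sep : forall T T', B T -> B T' -> `|T' - T| < R -> T = T')
  (B_net : forall t : int, exists2 T, B T & `|T - t| < R)
  (B_inv : forall T g, N g -> B T -> B (T + g.1))
  (W_sep : forall T x (z : int),
     W (T, x) -> W (T, x + z%:~R * mesh T) -> `|z| < K -> z = 0)
  (W_net : forall (T : int) (x : rat), exists2 z : int, `|z| < K & W (T, x + z%:~R * mesh T))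
  (W_inv : forall y g, N g -> W y -> W (rtrans y g)).

Definition layer (T t : int) : Prop :=
  [/\ B T, T <= t & forall T', B T' -> T < T' -> t < T'].

Definition near_wall (T : int) (x : rat) : Prop :=
  exists2 z : int, `|z| <= p & W (T, x + z%:~R * mesh T).

Definition near_level (r : int) (t : int) : Prop :=
  exists2 T, B T & `|t - T| <= r.

Definition wall_nbhd (y : int * rat) : Prop :=
  exists2 T, layer T y.1 & near_wall T y.2.

(* Close to a level the walls of the layer below it are continued upwards. *)
Definition thick_wall_nbhd (y : int * rat) : Prop :=
  wall_nbhd y \/ exists T T0, [/\ B T, `|y.1 - T| <= 2 * rho%:Z,
    layer T0 (T - 1) & near_wall T0 y.2].

(** A level closer than [R] to [t - R] lies strictly between [t - 2 * R] and [t], so the greatest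
    level not above [t] exists and is found in this range. *)
Lemma layer_ex t : exists2 T, layer T t & t - 2 * R < T.
Proof.
have [T' BT' T't] := B_net (t - R).
have ex : exists m : nat, `[< B (t - m%:Z) >].
  by exists (absz (t - T')%R); apply/asboolP; rewrite gez0_abs ?subKr //; lia.
case: (ex_minnP ex) => m /asboolP Bm minm.
have mT' : (m <= absz (t - T')%R)%N.
  by apply: minm; apply/asboolP; rewrite gez0_abs ?subKr //; lia.
exists (t - m%:Z); last by lia.
split=> // [|T'' BT'' lt]; first by lia.
rewrite ltNge; apply/negP => T''t.
have : (m <= absz (t - T'')%R)%N.
  by apply: minm; apply/asboolP; rewrite gez0_abs ?subKr //; lia.
by lia.
Qed.

Lemma layer_uniq T T' t : layer T t -> layer T' t -> T = T'.
Proof.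
move=> [BT Tt TM] [BT' T't T'M]; have := TM _ BT'; have := T'M _ BT.
by case: (ltgtP T T') => // _; lia.
Qed.

Lemma layer_bounds T t : layer T t -> T <= t < T + 2 * R.
Proof.
move=> lT; have [T' lT'] := layer_ex t; rewrite -(layer_uniq lT lT').
by case: lT; lia.
Qed.

Lemma layer_inv T t g : N g -> layer T t -> layer (T + g.1) (t + g.1).
Proof.
move=> Ng [BT Tt TM]; split; [exact: B_inv|by lia|move=> T' BT' lt].
have := TM (T' + (rinv g).1) (B_inv (NV Ng) BT').
by rewrite /rinv /=; lia.
Qed.

Lemma near_wall_inv T x g : N g -> near_wall T x ->
  near_wall (T + g.1) (rtrans (T, x) g).2.
Proof.
move=> Ng [z zp Wz]; exists z => //.
have := W_inv Ng Wz; rewrite /rtrans /= mulrDr addrAC.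
by rewrite mulrCA mesh_shift.
Qed.

Lemma near_level_inv r t g : N g -> near_level r t -> near_level r (t + g.1).
Proof. by move=> Ng [T BT tT]; exists (T + g.1); [exact: B_inv | lia]. Qed.

Lemma wall_nbhd_inv y g : N g -> wall_nbhd y -> wall_nbhd (rtrans y g).
Proof.
move=> Ng [T lT nT]; exists (T + g.1); first exact: layer_inv.
exact: near_wall_inv nT.
Qed.

Lemma thick_wall_nbhd_inv y g : N g -> thick_wall_nbhd y -> thick_wall_nbhd (rtrans y g).
Proof.
move=> Ng [/(wall_nbhd_inv Ng)|[T [T0 [BT yT lT0 nT0]]]]; first by left.
right; exists (T + g.1), (T0 + g.1); split; first exact: B_inv.
- by rewrite /=; lia.
- by have := layer_inv Ng lT0; rewrite addrAC.
- exact: near_wall_inv nT0.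
Qed.

(** On either side the net provides a wall, whose neighbourhood is too wide for one step. The sign
    [s] treats the two sides at once. *)
Lemma blocked_bound (T : int) (x0 : rat) (k : nat -> int) (L : nat) :
  k 0%N = 0 -> (forall i, (i < L)%N -> `|k i.+1 - k i| <= p) ->
  (forall i, (i <= L)%N -> ~ near_wall T (x0 + (k i)%:~R * mesh T)) ->
  forall i, (i <= L)%N -> `|k i| <= 3 * K.
Proof.
move=> k0 kS kN.
have [p0 K9] := (wall_width_gt0, wall_gap_gt9).
(* Searching around [K + p] gives a wall at [w] with [p < w < 2 * K + p], so the walk starts before
   it and is stopped at [w - 1]. *)
have side (s : int) : s = 1 \/ s = -1 -> forall i, (i <= L)%N -> s * k i <= 3 * K.
  move=> s1; have [z zK Wz] := W_net T (x0 + (s * (K + p))%:~R * mesh T).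
  pose w := K + p + s * z.
  have wE : W (T, x0 + (s * w)%:~R * mesh T).
    move: Wz; rewrite -addrA -mulrDl -intrD; congr (W (_, _ + _%:~R * _)).
    by rewrite /w; case: s1 => ->; lia.
  move=> i iL; apply: (@le_trans _ _ (w - 1)); last by rewrite /w; case: s1 => ->; lia.
  pose Q (y : int) := near_wall T (x0 + (s * y)%:~R * mesh T).
  apply: (@chain_blocked (fun i => s * k i) L p _ _ Q) (iL).
  - by rewrite k0 mulr0.
  - by move=> j /kS; case: s1 => ->; lia.
  - move=> j /kN; rewrite /Q; have -> // : s * (s * k j) = k j.
    by case: s1 => ->; lia.
  - by rewrite /w; case: s1 => ->; lia.
  move=> y yw; exists (s * (w - y)); first by case: s1 => ->; lia.
  move: wE; rewrite -addrA -mulrDl -intrD; congr (W (_, _ + _%:~R * _)).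
  by case: s1 => ->; lia.
move=> i iL; have := side 1 (or_introl erefl) i iL.
by have := side (-1) (or_intror erefl) i iL; lia.
Qed.

(** Points at most [7 * p] apart that are near walls of the same base are near the same wall, hence
    at most [2 * p] apart. With two bases this is [chain_clustered], since
    [7 * p = 3 * p + 2 * (2 * p)]. *)
Lemma clustered_bound (T T' : int) (x0 : rat) (k : nat -> int) (L : nat) :
  T <= T' <= T + 12 * rho%:Z ->
  k 0%N = 0 -> (forall i, (i < L)%N -> `|k i.+1 - k i| <= p) ->
  (forall i, (i <= L)%N -> near_wall T (x0 + (k i)%:~R * mesh T) \/
     near_wall T' (x0 + (k i)%:~R * mesh T)) ->
  forall i, (i <= L)%N -> `|k i| <= 3 * K.
Proof.
move=> TT' k0 kS kN.
have [p0 K9] := (wall_width_gt0, wall_gap_gt9).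
pose Q (s : int) U (y : int) := near_wall U (x0 + (s * y)%:~R * mesh T).
have clus (s : int) U : s = 1 \/ s = -1 -> T <= U <= T + 12 * rho%:Z ->
    forall y z, Q s U y -> Q s U z -> `|y - z| <= 7 * p -> `|y - z| <= 2 * p.
  move=> s1 TU y z [a ap Wa] [b bp Wb] yz.
  pose m := absz (U - T)%R.
  have [mr TE] : (m <= 12 * rho)%N /\ mesh T = (n ^+ m)%:~R * mesh U.
    split; first by rewrite /m; lia.
    by rewrite (mesh_exprn T m); congr (_ * mesh _); rewrite /m; lia.
  have q1 : 1 <= `|n| ^+ m by apply: exprn_ege1; exact: normn_ge1.
  have pq := wall_gap_gt mr.
  have yzq : `|s * (z - y) * n ^+ m| = `|y - z| * `|n| ^+ m.
    by rewrite !normrM normrX distrC; case: s1 => ->; rewrite ?normrN normr1 mul1r.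
  (* In units of [mesh U] the two walls differ by less than the gap, so they coincide. *)
  have zero : s * (z - y) * n ^+ m + b - a = 0.
    apply: (W_sep Wa).
      move: Wb; rewrite TE; congr (W (_, _)).
      by rewrite !(intrD, intrM, intrN); move: (mesh U) => u; ring.
    have h1 : `|y - z| * `|n| ^+ m <= 7 * p * `|n| ^+ m by rewrite ler_wpM2r // exprn_ge0.
    have h2 : p <= p * `|n| ^+ m by rewrite ler_peMr // ltW.
    move: yzq pq h1 h2 ap bp; rewrite -!(mulrA _ p).
    move: (s * (z - y) * n ^+ m) (`|y - z| * `|n| ^+ m) (p * `|n| ^+ m) p K => S u v p' K'.
    by lia.
  have : `|y - z| <= `|y - z| * `|n| ^+ m by rewrite ler_peMr.
  move: yzq zero ap bp; move: (s * (z - y) * n ^+ m) (`|y - z| * `|n| ^+ m) p => S u p'.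
  by lia.
have side (s : int) : s = 1 \/ s = -1 -> forall i, (i <= L)%N -> s * k i <= 3 * K.
  move=> s1 i iL; apply: (@le_trans _ _ (7 * p)); last by lia.
  apply: (@chain_clustered (fun i => s * k i) L p _ _ (Q s T) (Q s T') (2 * p)) (iL) => //.
  - by rewrite k0 mulr0.
  - by move=> j /kS; case: s1 => ->; lia.
  - by lia.
  - by lia.
  - move=> j /kN; rewrite /Q; have -> // : s * (s * k j) = k j.
    by case: s1 => ->; lia.
  - by apply: clus => //; lia.
  - exact: clus.
move=> i iL; have := side 1 (or_introl erefl) i iL.
by have := side (-1) (or_intror erefl) i iL; lia.
Qed.

(** * Chains inside faces, walls, edges and vertices *)

Section Chains.
Variables (f : nat -> int * rat) (L : nat).
Hypothesis f_adj : forall i, (i < L)%N -> adj rho P%:Z (f i) (f i.+1).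

Let conclusion := adj (33 * rho) (30 * P%:Z * `|n| ^+ (63 * rho)) (f 0%N) (f L).

(** Leaving the layer means crossing a level, but the chain avoids the strip of half-width [rho]
    around it, and [rho] is the largest change of level in a step. *)
Lemma layer_chain T : layer T (f 0%N).1 ->
  (forall i, (i <= L)%N -> ~ near_level rho (f i).1) ->
  forall i, (i <= L)%N -> layer T (f i).1.
Proof.
move=> lT fH; apply: (@chain_invariant _ (fun y => layer T y.1)) => // i iL [BT Tt TM].
have nH := fH i (ltnW iL); have [tt' _] := f_adj iL.
have far T' : B T' -> rho%:Z < `|(f i).1 - T'|.
  by move=> BT'; rewrite ltNge; apply/negP => le; apply: nH; exists T'.
split=> // [|T' BT' lt]; first by have := far T BT; lia.
by have := far T' BT'; have := TM T' BT' lt; lia.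
Qed.

Lemma level_chain (r : nat) : (r <= 2 * rho)%N ->
  (forall i, (i <= L)%N -> near_level r (f i).1) ->
  exists2 T, B T & forall i, (i <= L)%N -> `|(f i).1 - T| <= r%:Z.
Proof.
move=> rr fH; have [T BT T0] := fH 0%N isT; exists T => // i iL; move: i iL T0.
suff main i : (i <= L)%N -> `|(f 0%N).1 - T| <= r%:Z -> `|(f i).1 - T| <= r%:Z.
  by move=> i iL; apply: main.
elim: i => [//|i IH] iL h0; have [T' BT' T't] := fH i.+1 iL.
have [tt' _] := f_adj iL; have := IH (ltnW iL) h0 => ht.
have <- // : T' = T.
by apply: B_sep => //; rewrite /level_gap; lia.
Qed.

Lemma line_conclude (T : int) (k : nat -> int) :
  `|(f L).1 - (f 0%N).1| <= 33 * rho%:Z -> `|T - (f 0%N).1| <= 18 * rho%:Z ->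
  (forall i, (i <= L)%N -> (f i).2 = (f 0%N).2 + (k i)%:~R * mesh T) ->
  (forall i, (i <= L)%N -> `|k i| <= 3 * K) -> conclusion.
Proof.
move=> tt Tt fE kK; rewrite /conclusion.
have := fE L (leqnn L); have := kK L (leqnn L); move: tt Tt.
by case: (f 0%N) (f L) => [t x] [t' x'] /= tt Tt kL xE; apply: (adj_conclude tt Tt kL).
Qed.

Lemma face_chain :
  (forall i, (i <= L)%N -> ~ near_level rho (f i).1 /\ ~ wall_nbhd (f i)) -> conclusion.
Proof.
move=> fU; have [T lT _] := layer_ex (f 0%N).1.
have lTi := layer_chain lT (fun i iL => (fU i iL).1).
have b i (iL : (i <= L)%N) := layer_bounds (lTi i iL).
have [|k [k0 kS kE]] := chain_on_line (T := T) _ f_adj.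
  by move=> i iL; have := b i iL; rewrite /level_gap /mesh_exp; lia.
apply: (line_conclude (T := T) _ _ kE).
- by have := b _ (leqnn L); have := b 0%N isT; rewrite /level_gap; lia.
- by have := b 0%N isT; rewrite /level_gap; lia.
apply: (blocked_bound (T := T) (x0 := (f 0%N).2) k0 kS) => i iL; rewrite -kE // => nT.
by apply: (fU i iL).2; exists T => //; exact: lTi.
Qed.

Lemma wall_chain :
  (forall i, (i <= L)%N -> ~ near_level rho (f i).1 /\ wall_nbhd (f i)) -> conclusion.
Proof.
move=> fU; have [T lT _] := layer_ex (f 0%N).1.
have lTi := layer_chain lT (fun i iL => (fU i iL).1).
have b i (iL : (i <= L)%N) := layer_bounds (lTi i iL).
have [|k [k0 kS kE]] := chain_on_line (T := T) _ f_adj.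
  by move=> i iL; have := b i iL; rewrite /level_gap /mesh_exp; lia.
apply: (line_conclude (T := T) _ _ kE).
- by have := b _ (leqnn L); have := b 0%N isT; rewrite /level_gap; lia.
- by have := b 0%N isT; rewrite /level_gap; lia.
apply: (clustered_bound (T := T) (T' := T) (x0 := (f 0%N).2) _ k0 kS) => [|i iL]; first by lia.
rewrite -kE //; have [_ [T' lT' nT']] := fU i iL.
by left; rewrite (layer_uniq (lTi i iL) lT').
Qed.

Lemma layer_below T : B T -> exists T0, [/\ layer T0 (T - 1), T0 + R <= T & T <= T0 + 2 * R].
Proof.
move=> BT; have [T0 lT0 lo] := layer_ex (T - 1); exists T0; split=> //; last by lia.
case: lT0 => BT0 le _; rewrite leNgt; apply/negP => lt.
by have := B_sep BT0 BT; lia.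
Qed.

(** The walls of the layer below, continued across the level, block the chain on both sides of that
    level. *)
Lemma edge_chain :
  (forall i, (i <= L)%N -> near_level rho (f i).1 /\ ~ thick_wall_nbhd (f i)) -> conclusion.
Proof.
move=> fU; have [||T BT Ti] := @level_chain rho; [by lia|by move=> i /fU[]|].
have [T0 [lT0 T0T TT0]] := layer_below BT.
have [|k [k0 kS kE]] := chain_on_line (T := T0) _ f_adj.
  by move=> i iL; have := Ti i iL; move: T0T TT0; rewrite /level_gap /mesh_exp; lia.
have t0 := Ti 0%N isT; have tL := Ti _ (leqnn L).
apply: (line_conclude (T := T0) _ _ kE).
- by lia.
- by move: T0T TT0; rewrite /level_gap; lia.
apply: (blocked_bound (T := T0) (x0 := (f 0%N).2) k0 kS) => i iL; rewrite -kE // => nT.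
by apply: (fU i iL).2; right; exists T, T0; split=> //; have := Ti i iL; lia.
Qed.

(** Two kinds of walls meet at a level: those of the layer below, continued upwards, and those of
    the layer that begins there. They are the two kinds of [clustered_bound]. *)
Lemma vertex_chain :
  (forall i, (i <= L)%N -> near_level (2 * rho%:Z) (f i).1 /\ thick_wall_nbhd (f i)) ->
  conclusion.
Proof.
move=> fU; have [||T BT Ti] := @level_chain (2 * rho); [by lia|by move=> i /fU[]; rewrite PoszM|].
have [T0 [lT0 T0T TT0]] := layer_below BT.
have [|k [k0 kS kE]] := chain_on_line (T := T0) _ f_adj.
  by move=> i iL; have := Ti i iL; move: T0T TT0; rewrite /level_gap /mesh_exp; lia.
have t0 := Ti 0%N isT; have tL := Ti _ (leqnn L).
apply: (line_conclude (T := T0) _ _ kE).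
- by lia.
- by move: T0T TT0; rewrite /level_gap; lia.
apply: (clustered_bound (T := T0) (T' := T) (x0 := (f 0%N).2) _ k0 kS) => [|i iL].
  by move: T0T TT0; rewrite /level_gap; lia.
rewrite -kE //; have tT := Ti i iL.
case: (fU i iL).2 => [[T' lT' nT']|[T1 [T01 [BT1 tT1 lT01 nT01]]]]; last first.
  left; have TT1 : T1 = T by apply: B_sep => //; rewrite /level_gap; lia.
  by rewrite TT1 in lT01; rewrite (layer_uniq lT0 lT01).
have [Tt|tT'] := leP T (f i).1.
  right; suff lT : layer T (f i).1 by rewrite (layer_uniq lT lT').
  split=> // T'' BT'' lt; have := B_sep BT BT''.
  by move: lt tT; rewrite /level_gap; lia.
left; suff lT : layer T0 (f i).1 by rewrite (layer_uniq lT lT').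
case: lT0 => BT0 _ T0M; split=> //; first by move: T0T; rewrite /level_gap; lia.
by move=> T'' BT'' lt; have := T0M _ BT'' lt; lia.
Qed.

End Chains.

(** The middle family consists of horizontal edges, within [rho] of a level, and of pieces of walls,
    more than [2 * rho] from all levels. One step cannot pass from one kind to the other. *)
Lemma boundary_chain (f : nat -> int * rat) (L : nat) :
  (forall i, (i < L)%N -> adj rho P%:Z (f i) (f i.+1)) ->
  (forall i, (i <= L)%N -> (near_level rho (f i).1 \/ wall_nbhd (f i)) /\
     ~ (near_level (2 * rho%:Z) (f i).1 /\ thick_wall_nbhd (f i))) ->
  adj (33 * rho) (30 * P%:Z * `|n| ^+ (63 * rho)) (f 0%N) (f L).
Proof.
move=> fadj fU.
have near12 t : near_level rho t -> near_level (2 * rho%:Z) t.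
  by move=> [T BT tT]; exists T => //; lia.
have kind i : (i <= L)%N -> (near_level rho (f i).1 /\ ~ thick_wall_nbhd (f i)) \/
    (~ near_level (2 * rho%:Z) (f i).1 /\ wall_nbhd (f i)).
  move=> iL; have [[nl|wn] nb] := fU i iL.
    by left; split=> // tw; apply: nb; split=> //; apply: near12.
  by right; split=> // nl; apply: nb; split=> //; left.
have next i : (i < L)%N -> forall T, `|(f i).1 - T| <= rho%:Z -> `|(f i.+1).1 - T| <= 2 * rho%:Z.
  by move=> /fadj[tt _] T; lia.
have prev i : (i < L)%N -> forall T, `|(f i.+1).1 - T| <= rho%:Z -> `|(f i).1 - T| <= 2 * rho%:Z.
  by move=> /fadj[tt _] T; lia.
have [e0|w0] := kind 0%N isT.
  apply: edge_chain => //.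
  apply: (@chain_invariant _ (fun y => near_level rho y.1 /\ ~ thick_wall_nbhd y)) => // i iL.
  move=> [[T BT tT] _]; have [//|[nl _]] := kind _ iL.
  by case: nl; exists T => //; apply: next iL _ _.
apply: wall_chain => //.
suff main : forall i, (i <= L)%N -> ~ near_level (2 * rho%:Z) (f i).1 /\ wall_nbhd (f i).
  by move=> i /main[nl wn]; split=> // /near12.
apply: (@chain_invariant _ (fun y => ~ near_level (2 * rho%:Z) y.1 /\ wall_nbhd y)) => // i iL.
move=> [nl _]; have [[[T BT tT] _]|//] := kind _ iL.
by case: nl; exists T => //; apply: prev iL _ _.
Qed.

End LevelsAndWalls.

Lemma coordinate_cover : exists U : 'I_3 -> set (int * rat),
  [/\ forall y, exists j, U j y,
      forall j y g, N g -> U j y -> U j (rtrans y g)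
    & forall j (f : nat -> int * rat) (L : nat),
        (forall i, (i <= L)%N -> U j (f i)) ->
        (forall i, (i < L)%N -> adj rho P%:Z (f i) (f i.+1)) ->
        adj (33 * rho) (30 * P%:Z * `|n| ^+ (63 * rho)) (f 0%N) (f L)].
Proof.
have [B [Bs Bn Bi]] := levels_exist; have [W [Ws Wn Wi]] := walls_exist.
pose thin y := near_level B rho y.1 \/ wall_nbhd B W y.
pose thick y := near_level B (2 * rho%:Z) y.1 /\ thick_wall_nbhd B W y.
pose U (j : 'I_3) : set (int * rat) := fun y => match val j with
  | 0 => ~ thin y | 1 => thin y /\ ~ thick y | _ => thick y end.
have thin_inv y g : N g -> thin y -> thin (rtrans y g).
  move=> Ng [nl|wn]; [left | right].
    exact: (near_level_inv Bi Ng nl).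
  exact: (wall_nbhd_inv Bi Wi Ng wn).
have thick_inv y g : N g -> thick y -> thick (rtrans y g).
  move=> Ng [nl tw]; split.
    exact: (near_level_inv Bi Ng nl).
  exact: (thick_wall_nbhd_inv Bi Wi Ng tw).
exists U; split=> [y|[[|[|j]] jlt] y g Ng|[[|[|j]] jlt] f L fU fadj].
- have [t|nt] := pselect (thin y); last by exists (Ordinal (isT : 0 < 3)%N).
  have [k|nk] := pselect (thick y); first by exists (Ordinal (isT : 2 < 3)%N).
  by exists (Ordinal (isT : 1 < 3)%N).
- rewrite /U /=; by move=> nt /(thin_inv _ _ (NV Ng)); rewrite rtransK.
- rewrite /U /= => -[t nk]; split; first exact: thin_inv.
  by move=> /(thick_inv _ _ (NV Ng)); rewrite rtransK.
- exact: thick_inv.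
- apply: (face_chain Bn Wn fadj) => i iL.
  by split=> h; apply: (fU i iL); [left | right].
- exact: (boundary_chain Bs Bn Ws Wn fadj fU).
- exact: (vertex_chain Bs Bn Ws fadj fU).
Qed.

End Cover.

(** * Invariant covers of the group *)

Section GroupCover.
Local Open Scope ring_scope.
Variables (n : int) (n_neq0 : n != 0).
Local Notation nQ := (n%:~R : rat).
Local Notation G := (BS1 n).
Let tcMn := tcM n_neq0.
Let xcMn := xcM n_neq0.
Let tcVn := tcV n_neq0.
Let xcVn := xcV n_neq0.
Let nQDn := nQD n_neq0.

Lemma subgroupV (H : set G) x : is_subgroup H -> H x -> H (x^-1)%g.
Proof. by move=> [H1 HF] Hx; rewrite -div1g; apply: HF. Qed.

Lemma subgroupM (H : set G) x y : is_subgroup H -> H x -> H y -> H (x * y)%g.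
Proof.
move=> sH Hx Hy; rewrite -[y]invgK; apply: sH.2 => //.
exact: subgroupV.
Qed.

(** Stated for any homomorphism [theta], since the case n = 1 needs coordinates that depend on N. *)
Lemma pullback_cover (rho P : nat) (theta : G -> int * rat) (N : set G) :
  (0 < rho)%N -> (0 < P)%N ->
  (forall g h, theta (g * h)%g = rtrans n (theta g) (theta h)) ->
  is_subgroup N ->
  (forall g, N g -> `|(theta g).1| < level_gap rho -> (theta g).1 = 0) ->
  (forall g (T z : int), N g -> theta g = (0, z%:~R * mesh n rho T) ->
     `|z| < wall_gap n rho P -> z = 0) ->
  exists U : 'I_3 -> set G,
  [/\ forall x, exists j, U j x,
      forall j x g, N g -> U j x -> U j (x * g)%g
    & forall j (f : nat -> G) (L : nat),
        (forall i, (i <= L)%N -> U j (f i)) ->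
        (forall i, (i < L)%N -> adj n rho P%:Z (theta (f i)) (theta (f i.+1))) ->
        adj n (33 * rho) (30 * P%:Z * `|n| ^+ (63 * rho)) (theta (f 0%N)) (theta (f L))].
Proof.
move=> rho0 P0 thM sN N_level N_wall.
have th1 : theta 1%g = (0, 0).
  have := thM 1%g 1%g; rewrite mulg1; case: (theta 1%g) => t x [t0].
  have -> : t = 0 by lia.
  by rewrite oppr0 expr0z mul1r => xx; have -> : x = 0 by lra.
have thV g : theta (g^-1)%g = (- (theta g).1, - (nQ ^ (theta g).1 * (theta g).2)).
  have := thM g (g^-1)%g; rewrite mulgV th1; case: (theta (g^-1)%g) => t x [].
  move=> /eqP; rewrite eq_sym addrC addr_eq0 => /eqP ->.
  by rewrite opprK => /eqP; rewrite eq_sym addrC addr_eq0 => /eqP ->.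
pose N' (z : int * rat) := exists2 g, N g & z = theta g.
have [|||||U [Uc Ui Uf]] := @coordinate_cover n n_neq0 rho P rho0 P0 N'.
- by exists 1%g; [exact: sN.1 | rewrite th1].
- move=> _ _ [g Ng ->] [h Nh ->]; exists (g * h)%g => //; exact: subgroupM.
- by move=> _ [g Ng ->]; exists (g^-1)%g; [exact: subgroupV | rewrite thV].
- by move=> _ [g Ng ->]; exact: N_level.
- by move=> T z [g Ng /esym gE]; exact: N_wall gE.
exists (fun j => (theta @^-1` U j)%classic); split=> [x|j x g Ng Ujx|j f L fU fadj].
- exact: Uc.
- by rewrite /preimage /= thM; apply: Ui => //; exists g.
- exact: (Uf j (theta \o f) L fU fadj).
Qed.

Definition coord (g : G) : int * rat := (tc g, xc g).

Lemma coordM g h : coord (g * h)%g = rtrans n (coord g) (coord h).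
Proof. by rewrite /coord tcMn xcMn /rtrans /= [xc h + _]addrC. Qed.

Lemma adj_inboxP (r : nat) (p : int) (g h : G) :
  adj n r p (coord g) (coord h) <-> inbox r p (h / g)%g.
Proof.
have nu : nQ ^ (tc g) != 0 by rewrite expfz_neq0 // nQ_neq0.
have key (k : int) : xc h = xc g + k%:~R * nQ ^ (- (tc g + r%:Z)) <->
    xc (h / g)%g = k%:~R * nQ ^ (- r%:Z).
  rewrite xcMn xcVn tcVn opprK opprD nQDn.
  have e : nQ ^ tc g * nQ ^ (- tc g) = 1 by rewrite -nQDn subrr.
  move: (nQ ^ tc g) (nQ ^ (- tc g)) (nQ ^ (- r%:Z)) e {nu} => u v w e.
  split=> [->|E]; first by rewrite -[RHS]mul1r -e; ring.
  have -> : k%:~R * (v * w) = v * (k%:~R * w) by ring.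
  by rewrite -E -[LHS]mul1r -[X in _ = X + _]mul1r -e; ring.
rewrite /adj /inbox /= tcMn tcVn.
by split=> -[tE [k kp kE]]; split=> //; exists k => //; apply/key.
Qed.

(** Since N is normal, a translation in N may be rescaled until it is an integer; one finite set
    then controls the walls at all heights. *)
Lemma coord_conj_b (g : G) (s : int) : tc g = 0 -> exists y : G,
  tc (g ^ y)%g = 0 /\ xc (g ^ y)%g = nQ ^ s * xc g.
Proof.
move=> t0.
have [y [ty xy]] : exists y : G, tc y = - s /\ xc y = 0.
  case: s => m.
    exists (gen_b n ^- m)%g; exact: coord_bVX.
  exists (gen_b n ^+ m.+1)%g; rewrite NegzE opprK; exact: coord_bX.
exists y; rewrite conjgE !tcMn !xcMn xcVn tcVn t0 xy ty.
by rewrite !(add0r, mulr0, opprK, oppr0, addr0, addNr, subrr).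
Qed.

(** The value does not involve [xc g]: an element of small level and arbitrary [x] yields a
    translation of controlled size. *)
Lemma coord_commutator (g : G) :
  tc [~ g, gen_a n]%g = 0 /\ xc [~ g, gen_a n]%g = 1 - nQ ^ (- tc g).
Proof.
have E : [~ g, gen_a n]%g = (g^-1 * ((gen_a n)^-1 * (g * gen_a n)))%g by [].
rewrite E !tcMn !xcMn !tcMn !tcVn !xcVn tc_a // xc_a //.
rewrite oppr0 !expr0z !mul1r !(add0r, addr0); split; first by rewrite addNr.
have e : nQ ^ (- tc g) * nQ ^ tc g = 1 by rewrite -nQDn addNr.
move: (nQ ^ (- tc g)) (nQ ^ (tc g)) e => u v e.
transitivity (1 - u + xc g * (1 - u * v)); first by ring.
by rewrite e subrr mulr0 addr0.
Qed.

Lemma exprz_eq1 (t : int) : nQ ^ t = 1 -> t != 0 -> `|n| = 1.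
Proof.
have pos (m : nat) : nQ ^ m%:Z = 1 -> (0 < m)%N -> `|n| = 1.
  move=> E m0; apply/eqP; rewrite -(@pexpr_eq1 _ `|n| m) //.
  have : (n ^+ m)%:~R = 1%:~R :> rat by rewrite rmorphXn.
  by move=> /intr_inj E'; rewrite -normrX E' normr1.
move=> E t0; apply: (pos (absz t)); last by rewrite absz_gt0.
case: t E {t0} => m //; rewrite NegzE -invr_expz => E.
by rewrite -[LHS]invrK E invr1.
Qed.

Lemma group_cover_neq1 (rho P : nat) : (0 < rho)%N -> (0 < P)%N -> n != 1 ->
  exists (rho' : nat) (P' : int) (F : set G), finite_set F /\
  forall N : set G, is_normal_subgroup N -> (forall x, N x -> F x -> x = 1%g) ->
  exists U : 'I_3 -> set G,
  [/\ forall x, exists j, U j x,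
      forall j x g, N g -> U j x -> U j (x * g)%g
    & forall j (f : nat -> G) (L : nat),
        (forall i, (i <= L)%N -> U j (f i)) ->
        (forall i, (i < L)%N -> inbox rho P%:Z (f i.+1 / f i)%g) ->
        inbox rho' P' (f L / f 0%N)%g].
Proof.
move=> rho0 P0 n1.
(* [J] bounds both kinds of integer translations to be excluded: wall displacements below the gap,
   and rescaled commutators, which are differences of two powers of [n] with exponents at most
   [12 * rho]. *)
pose J := wall_gap n rho P + 2 * `|n| ^+ (12 * rho).
have q1 := normn_ge1 n_neq0.
have qge (m m' : nat) : (m <= m')%N -> `|n| ^+ m <= `|n| ^+ m'.
  by move=> mm; apply: ler_weXn2l.
have K0 : 0 < wall_gap n rho P.
  by have := wall_gap_gt9 n_neq0 rho0 P0; have := wall_width_gt0 n_neq0 rho0 P0; lia.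
pose F := inbox (n := n) (12 * rho) (J * `|n| ^+ (12 * rho)).
have inF (g : G) (k : int) : tc g = 0 -> xc g = k%:~R -> `|k| <= J -> F g.
  move=> t0 xk kJ; split; first by rewrite t0.
  exists (k * n ^+ (12 * rho)).
    by rewrite normrM normrX ler_wpM2r ?exprn_ge0.
  by rewrite xk intrM rmorphXn [X in _ * X * _]exprnP -mulrA -nQDn subrr mulr1.
exists (33 * rho)%N, (30 * P%:Z * `|n| ^+ (63 * rho)), F; split; first exact: finite_inbox.
move=> N [sN nN] NF.
have trivial_on_a g k : N g -> tc g = 0 -> xc g = k%:~R -> `|k| <= J -> k = 0.
  move=> Ng t0 xk kJ; have g1 := NF g Ng (inF g k t0 xk kJ).
  by move: xk; rewrite g1 xc1 // => /esym/eqP; rewrite intr_eq0 => /eqP.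
have [||||U [Uc Ui Uf]] := @pullback_cover rho P coord N rho0 P0.
- exact: coordM.
- exact: sN.
(* Conjugation rescales the commutator by [n ^ (6 * rho)], enough to clear its denominator as the
   level is below [6 * rho]. The resulting integer translation lies in [F], so it is trivial and
   [n ^ (- tc g) = 1]. *)
- move=> g Ng /= tR.
  have [tc0 xcE] := coord_commutator g.
  have Nc : N [~ g, gen_a n]%g.
    by rewrite commgEl; apply: subgroupM => //; [exact: subgroupV | exact: nN].
  have [y [ty xy]] := coord_conj_b (6 * rho)%N%:Z tc0.
  have tR' : `|tc g| < 6 * rho%:Z by [].
  pose m := absz (6 * rho%:Z - tc g)%R.
  have mE : m%:Z = 6 * rho%:Z - tc g by rewrite /m; lia.
  have /trivial_on_a := nN _ y Nc.
  move=> /(_ (n ^+ (6 * rho) - n ^+ m) ty) => E.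
  have {}E : n ^+ (6 * rho) - n ^+ m = 0.
    apply: E.
      rewrite xy xcE mulrBr mulr1 -nQDn intrB !rmorphXn ![X in _ = X - _]exprnP.
      by rewrite [X in _ = _ - X]exprnP mE PoszM.
    apply: le_trans (ler_normB _ _) _; rewrite !normrX /J.
    have : `|n| ^+ (6 * rho) <= `|n| ^+ (12 * rho) by apply: qge; lia.
    have : `|n| ^+ m <= `|n| ^+ (12 * rho) by apply: qge; rewrite /m; lia.
    by move: K0; lia.
  apply/eqP; apply/negPn/negP => t0.
  have nt1 : nQ ^ (- tc g) = 1.
    have : (n ^+ (6 * rho))%:~R - (n ^+ m)%:~R = 0 :> rat by rewrite -intrB E.
    rewrite !rmorphXn ![X in X - _]exprnP [X in _ - X]exprnP mE -PoszM nQDn.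
    move=> /eqP; rewrite -{1}[_ ^ _]mulr1 -mulrBr mulf_eq0 expfz_eq0 (negbTE (nQ_neq0 n_neq0)) andbF /=.
    by rewrite subr_eq0 => /eqP.
  have nq1 := exprz_eq1 nt1 (etrans (congr1 negb (oppr_eq0 _)) t0).
  (* What remains is the Klein bottle group with [(-1) ^ (- tc g) = 1]. Conjugation by [b] changes
     the sign of [x], so [g * g ^ b] has [x = 0] and twice the level, still within the bound
     [12 * rho] of [F]. *)
  have nm1 : n = -1 by move: nq1 n1; lia.
  have Ngb : N (g * g ^ gen_b n)%g by apply: subgroupM => //; exact: nN.
  have tE : tc (g * g ^ gen_b n)%g = 2 * tc g.
    by rewrite conjgE !tcMn tcVn; lia.
  have xE : xc (g * g ^ gen_b n)%g = 0.
    rewrite conjgE !xcMn !tcMn tcVn xcVn tc_b // xc_b //.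
    rewrite !(mulr0, oppr0, add0r, addr0) addrCA addNr addr0 nt1 mul1r.
    have -> : nQ ^ (-1) = -1 by rewrite nm1.
    by rewrite mulN1r addNr.
  have /(NF _ Ngb) gb1 : F (g * g ^ gen_b n)%g.
    split; first by rewrite tE; lia.
    by exists 0; [rewrite mulr_ge0 ?exprn_ge0 // /J; have := exprn_ge0 (12 * rho) (normr_ge0 n); lia | rewrite xE mul0r].
  by move: tE t0; rewrite gb1 tc1 //; lia.
- move=> g T z Ng [t0 xE] zK.
  have [y [ty xy]] := coord_conj_b (T + (mesh_exp rho)%:Z) t0.
  have /trivial_on_a := nN _ y Ng; apply; [exact: ty | | by rewrite /J; have := exprn_ge0 (12 * rho) (normr_ge0 n); lia].
  by rewrite xy xE mulrCA /mesh -nQDn subrr mulr1.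
exists U; split=> // j f L fU fadj; apply/adj_inboxP; apply: (Uf j) => // i iL.
by apply/adj_inboxP; apply: fadj.
Qed.

End GroupCover.

(** * The case n = 1 *)

Section AbelianCase.
Local Open Scope ring_scope.
Lemma sqr_le_of_norm (b c : int) : `|b| <= c -> b ^+ 2 <= c ^+ 2.
Proof. by move=> bc; rewrite -(real_normK (num_real b)) lerXn2r // nnegrE; lia. Qed.

Lemma normsum_sqr (p q : int) : (`|p| + `|q|) ^+ 2 <= 2 * (p ^+ 2 + q ^+ 2).
Proof.
rewrite -(real_normK (num_real p)) -(real_normK (num_real q)) -subr_ge0.
have -> : 2 * (`|p| ^+ 2 + `|q| ^+ 2) - (`|p| + `|q|) ^+ 2 = (`|p| - `|q|) ^+ 2 by ring.
exact: sqr_ge0.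
Qed.

(** Otherwise [b ^+ 2] is at most [72 * D * r ^+ 2], below (72 / 169) D ^ 2, and [c ^+ 2] is at most
    D ^ 2 / 4, so their sum cannot reach [D * m]. *)
Lemma no_short_transverse (b c l D m r : int) : 0 <= r -> 0 <= l -> 169 * r ^+ 2 < D -> l ^+ 2 <= 2 * D ->
  b ^+ 2 + c ^+ 2 = D * m -> D <= m -> 2 * `|c| <= D -> 6 * (l * r) <= `|b|.
Proof.
move=> r0 l0 rD lD bcm Dm cD; rewrite leNgt; apply/negP => bl.
have D0 : 0 < D by apply: le_lt_trans rD; rewrite mulr_ge0 ?sqr_ge0.
have c2 : (2 * c) ^+ 2 <= D ^+ 2 by apply: sqr_le_of_norm; rewrite normrM.
have b2 : b ^+ 2 <= (6 * (l * r)) ^+ 2 by apply: sqr_le_of_norm; lia.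
have l2 : l ^+ 2 * r ^+ 2 <= 2 * D * r ^+ 2 by rewrite ler_wpM2r ?sqr_ge0.
have D2 : D * D <= D * m by rewrite ler_wpM2l // ltW.
have Dr : D * (169 * r ^+ 2) < D * D by rewrite ltr_pM2l.
by move: c2 b2 l2 D2 Dr bcm; rewrite !exprMn !expr2; lia.
Qed.

(** The margin is [2 * 9 ^ 2 = 162 < 169 = 13 ^ 2], which explains the box of size [13 * r] avoided
    by N. *)
Lemma no_short_parallel (c l D m r : int) : 0 <= r -> 0 <= l -> 169 * r ^+ 2 < D -> l ^+ 2 <= 2 * D ->
  c ^+ 2 = D * m -> D <= m -> 9 * (l * r) + 1 <= `|c|.
Proof.
move=> r0 l0 rD lD cm Dm; rewrite leNgt; apply/negP => cl.
have D0 : 0 < D by apply: le_lt_trans rD; rewrite mulr_ge0 ?sqr_ge0.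
have c2 : c ^+ 2 <= (9 * (l * r)) ^+ 2 by apply: sqr_le_of_norm; lia.
have l2 : l ^+ 2 * r ^+ 2 <= 2 * D * r ^+ 2 by rewrite ler_wpM2r ?sqr_ge0.
have D2 : D * D <= D * m by rewrite ler_wpM2l // ltW.
have Dr : D * (169 * r ^+ 2) < D * D by rewrite ltr_pM2l.
by move: c2 l2 D2 Dr cm; rewrite !exprMn !expr2; lia.
Qed.

Local Notation G := (BS1 1).
Let n1 : (1 : int) != 0 := isT.

Let xc11 : xc (1%g : G) = 0 := xc1 n1.
Let tc11 : tc (1%g : G) = 0 := tc1 n1.

Definition xi (g : G) : int := numq (xc g).

Lemma xcE1 (g : G) : xc g = (xi g)%:~R.
Proof.
have [k [j E]] := xc_denom n1 g.
by rewrite /xi E exp1rz mulr1 numq_int.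
Qed.

Lemma tcM1 (g h : G) : tc (g * h)%g = tc g + tc h.
Proof. exact: tcM. Qed.

Lemma xiM (g h : G) : xi (g * h)%g = xi g + xi h.
Proof.
apply: (@intr_inj rat); rewrite intrD -!xcE1 xcM // exp1rz mul1r addrC //.
Qed.

Lemma coord_eq11 (g : G) : tc g = 0 -> xi g = 0 -> g = 1%g.
Proof. by move=> t0 x0; apply: coord_eq1 => //; rewrite xcE1 x0. Qed.

Lemma tcV1 (g : G) : tc (g^-1)%g = - tc g.
Proof. exact: tcV. Qed.

Lemma xiV (g : G) : xi (g^-1)%g = - xi g.
Proof.
have := xiM g (g^-1)%g; rewrite mulgV.
have -> : xi 1%g = 0 by rewrite /xi xc11.
by lia.
Qed.

Lemma int_power (N : set G) (g : G) (j : int) : is_subgroup N -> N g ->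
  exists h, [/\ N h, tc h = j * tc g & xi h = j * xi g].
Proof.
move=> sN Ng.
have pos (m : nat) : exists h, [/\ N h, tc h = m%:Z * tc g & xi h = m%:Z * xi g].
  elim: m => [|m [h [Nh th xh]]].
    by exists 1%g; rewrite !mul0r; split; [exact: sN.1 | exact: tc11 | rewrite /xi xc11].
  exists (g * h)%g; split; [exact: subgroupM| |].
    by rewrite tcM1 th intS mulrDl mul1r.
  by rewrite xiM xh intS mulrDl mul1r.
case: j => m; first exact: pos.
have [h [Nh th xh]] := pos m.+1; exists (h^-1)%g; split.
- exact: subgroupV.
- by rewrite tcV1 th NegzE mulNr.
- by rewrite xiV xh NegzE mulNr.
Qed.

Definition transverse (p q : int) (g : G) : int := p * xi g - q * tc g.
Definition parallel (p q : int) (g : G) : int := p * tc g + q * xi g.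

Lemma inbox1 (r : nat) (P : int) (g : G) : inbox r P g <-> `|tc g| <= r%:Z /\ `|xi g| <= P.
Proof.
split=> -[tr h]; split=> //.
  case: h => k kP; rewrite exp1rz mulr1 => xk.
  by rewrite /xi xk numq_int.
by exists (xi g) => //; rewrite exp1rz mulr1 xcE1.
Qed.

(* For a shortest vector (p, q) and D = p^2 + q^2, every nontrivial lattice vector
   has transverse^2 + parallel^2 = D * |v|^2 >= D^2, while adding multiples of
   (p, q) makes parallel at most D / 2 and leaves transverse unchanged. *)
Lemma short_direction (r : nat) (N : set G) : (0 < r)%N -> is_subgroup N ->
  (forall x, N x -> inbox (13 * r) (13 * r)%N%:Z x -> x = 1%g) ->
  exists p q : int, [/\ (p != 0) || (q != 0),
    forall g, N g -> `|transverse p q g| < 6 * ((`|p| + `|q|) * r%:Z) -> transverse p q g = 0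
  & forall g, N g -> transverse p q g = 0 ->
      `|parallel p q g| < 9 * ((`|p| + `|q|) * r%:Z) + 1 -> parallel p q g = 0].
Proof.
move=> r0 sN NF.
have [triv|ntriv] := pselect (forall x, N x -> x = 1%g).
  exists 1, 0; split=> // g /triv ->; rewrite /transverse /parallel /xi xc11 tc11 //.
have [g0 Ng0 g01] : exists2 g, N g & g <> 1%g.
  by apply: contrapT => h; apply: ntriv => x Nx; apply: contrapT => x1; apply: h; exists x.
pose nrm (g : G) : nat := absz (tc g ^+ 2 + xi g ^+ 2)%R.
have nrmE g : (nrm g)%:Z = tc g ^+ 2 + xi g ^+ 2.
  by rewrite /nrm gez0_abs // addr_ge0 ?sqr_ge0.
have ex : exists m : nat, `[< exists g, [/\ N g, g <> 1%g & nrm g = m] >].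
  by exists (nrm g0); apply/asboolP; exists g0.
case: (ex_minnP ex) => m /asboolP[v [Nv v1 vm]] minm.
have minD g : N g -> g <> 1%g -> tc v ^+ 2 + xi v ^+ 2 <= tc g ^+ 2 + xi g ^+ 2.
  move=> Ng g1; rewrite -!nrmE vm lez_nat; apply: minm; apply/asboolP.
  by exists g.
have vbig : 169 * (r%:Z ^+ 2) < tc v ^+ 2 + xi v ^+ 2.
  rewrite ltNge; apply/negP => le; apply: v1; apply: NF => //; apply/inbox1.
  by move: le; rewrite !expr2; split; nia.
have eq1 g : tc g ^+ 2 + xi g ^+ 2 = 0 -> g = 1%g.
  by move=> e; apply: coord_eq11; nia.
exists (tc v), (xi v).
move: vbig minD; set p := tc v; set q := xi v; set D := p ^+ 2 + q ^+ 2 => vbig minD.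
have L2 : (`|p| + `|q|) ^+ 2 <= 2 * D := normsum_sqr p q.
have id2 g : transverse p q g ^+ 2 + parallel p q g ^+ 2 = D * (tc g ^+ 2 + xi g ^+ 2).
  by rewrite /transverse /parallel /D; ring.
have D0 : 0 < D by apply: le_lt_trans vbig; rewrite mulr_ge0 ?sqr_ge0.
split.
- by rewrite -negb_and; apply/negP => /andP[/eqP p0 /eqP q0]; move: D0; rewrite /D p0 q0.
- move=> g Ng small; apply: contrapT => /eqP t0.
  (* Minus the integer nearest to [parallel / D]. *)
  pose j := - ((2 * parallel p q g + D) %/ (2 * D))%Z.
  have [h [Nh th xh]] := int_power j sN Nv.
  have tE : transverse p q (g * h)%g = transverse p q g.
    by rewrite /transverse tcM1 xiM th xh -/p -/q; ring.
  have pE : parallel p q (g * h)%g = parallel p q g + j * D.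
    by rewrite /parallel tcM1 xiM th xh -/p -/q /D; ring.
  have half : 2 * `|parallel p q g + j * D| <= D.
    have := divz_eq (2 * parallel p q g + D) (2 * D).
    have := modz_ge0 (2 * parallel p q g + D) (_ : 2 * D != 0).
    have := ltz_pmod (2 * parallel p q g + D) (_ : 0 < 2 * D).
    move=> /(_ ltac:(lia)) lt /(_ ltac:(lia)) ge.
    by rewrite /j; move: lt ge; move: (_ %% _)%Z (_ %/ _)%Z => a b; lia.
  have gh1 : (g * h)%g <> 1%g.
    move=> e; move: tE t0; rewrite e => <-.
    by rewrite /transverse /xi xc11 tc11 /= !mulr0 subrr eqxx.
  have := minD _ (subgroupM sN Ng Nh) gh1; have := id2 (g * h)%g; rewrite tE pE.
  move=> e le; have := no_short_transverse (ltW (_ : 0 < r%:Z)) _ vbig L2 e le half.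
  by move=> /(_ r0) /(_ (addr_ge0 (normr_ge0 _) (normr_ge0 _))); move: small; lia.
- move=> g Ng t0 small.
  have [->|g1] := pselect (g = 1%g); first by rewrite /parallel /xi xc11 tc11 /= !mulr0 addr0.
  have := minD _ Ng g1; have := id2 g; rewrite t0.
  rewrite expr0n add0r => e le.
  have := no_short_parallel (ltW (_ : 0 < r%:Z)) _ vbig L2 e le.
  by move=> /(_ r0) /(_ (addr_ge0 (normr_ge0 _) (normr_ge0 _))); move: small; lia.
Qed.

(** Two factors [|p| + |q|] appear, one from the hypotheses and one from inverting the change of
    coordinates; division by [p ^+ 2 + q ^+ 2] cancels both up to a factor 2, so the bound is free
    of the shortest vector. *)
Lemma coordinate_bound (p q b c t r : int) : 0 < p ^+ 2 + q ^+ 2 ->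
  `|b| <= 33 * ((`|p| + `|q|) * r) -> `|c| <= 33 * ((`|p| + `|q|) * r) ->
  (p ^+ 2 + q ^+ 2) * t = p * c + q * b -> `|t| <= 66 * r.
Proof.
move=> D0 bB cB E.
rewrite -(ler_pM2l D0) -{1}(gtr0_norm D0) -normrM E.
have h1 : `|p| * `|c| <= `|p| * (33 * ((`|p| + `|q|) * r)) by rewrite ler_wpM2l.
have h2 : `|q| * `|b| <= `|q| * (33 * ((`|p| + `|q|) * r)) by rewrite ler_wpM2l.
have r0 : 0 <= r.
  have : 0 <= (`|p| + `|q|) * r by lia.
  rewrite pmulr_rge0 // lt_neqAle addr_ge0 // andbT eq_sym.
  apply/eqP => pq0; have [p0 q0] : p = 0 /\ q = 0 by split; lia.
  by move: D0; rewrite p0 q0.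
apply: le_trans (ler_normD _ _) _; rewrite !normrM; apply: le_trans (lerD h1 h2) _.
have -> : `|p| * (33 * ((`|p| + `|q|) * r)) + `|q| * (33 * ((`|p| + `|q|) * r)) =
  33 * r * (`|p| + `|q|) ^+ 2 by ring.
have -> : (p ^+ 2 + q ^+ 2) * (66 * r) = 33 * r * (2 * (p ^+ 2 + q ^+ 2)) by ring.
by rewrite ler_wpM2l ?normsum_sqr // mulr_ge0.
Qed.

Lemma group_cover1 (rho P : nat) : (0 < rho)%N -> (0 < P)%N ->
  exists (rho' : nat) (P' : int) (F : set G), finite_set F /\
  forall N : set G, is_normal_subgroup N -> (forall x, N x -> F x -> x = 1%g) ->
  exists U : 'I_3 -> set G,
  [/\ forall x, exists j, U j x,
      forall j x g, N g -> U j x -> U j (x * g)%g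
    & forall j (f : nat -> G) (L : nat),
        (forall i, (i <= L)%N -> U j (f i)) ->
        (forall i, (i < L)%N -> inbox rho P%:Z (f i.+1 / f i)%g) ->
        inbox rho' P' (f L / f 0%N)%g].
Proof.
move=> rho0 P0; pose r := (rho + P)%N.
have r0 : (0 < r)%N by rewrite /r; lia.
pose F := inbox (n := 1) (13 * r) (13 * r)%N%:Z.
exists (66 * r)%N, (66 * r)%N%:Z, F; split; first exact: finite_inbox.
move=> N [sN _] NF; have [p [q [pq0 Nt Np]]] := short_direction r0 sN NF.
pose l := (absz p + absz q)%N.
have lE : l%:Z = `|p| + `|q| by rewrite /l; lia.
have lr0 : (0 < l * r)%N by rewrite muln_gt0 r0 andbT /l; move: pq0; lia.
have lrE : (l * r)%N%:Z = (`|p| + `|q|) * r%:Z by rewrite PoszM lE.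
pose theta (g : G) : int * rat := (transverse p q g, (parallel p q g)%:~R).
have tM g h : transverse p q (g * h)%g = transverse p q g + transverse p q h.
  by rewrite /transverse tcM1 xiM; ring.
have pM g h : parallel p q (g * h)%g = parallel p q g + parallel p q h.
  by rewrite /parallel tcM1 xiM; ring.
have tV g : transverse p q (g^-1)%g = - transverse p q g.
  by rewrite /transverse tcV1 xiV; ring.
have pV g : parallel p q (g^-1)%g = - parallel p q g.
  by rewrite /parallel tcV1 xiV; ring.
(* The new coordinates stretch lengths by about [l], so [l * r] serves as both step sizes. It
   depends on N; the final bound [66 * r] does not. *)
have [||||U [Uc Ui Uf]] := @pullback_cover 1 n1 (l * r) (l * r) theta N lr0 lr0.
- by move=> g h; rewrite /theta /rtrans /= exp1rz mul1r tM pM intrD.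
- exact: sN.
- by move=> g Ng; rewrite /level_gap lrE; exact: Nt.
- move=> g T z Ng [t0 /eqP]; rewrite /mesh exp1rz mulr1 eqr_int => /eqP <-.
  by rewrite /wall_gap /wall_width normr1 !expr1n !mulr1 lrE; exact: Np.
exists U; split=> // j f L fU fadj; apply/inbox1.
have : adj 1 (33 * (l * r)) (30 * (l * r)%N%:Z * `|1| ^+ (63 * (l * r)))
    (theta (f 0%N)) (theta (f L)).
  apply: (Uf j) => // i iL; have /inbox1[tB xB] := fadj i iL.
  move: (f i) (f i.+1) tB xB => g h tB xB.
  have ht : transverse p q (h / g)%g = transverse p q h - transverse p q g by rewrite tM tV.
  have hp : parallel p q (h / g)%g = parallel p q h - parallel p q g by rewrite pM pV.
  have bnd (a b : int) : `|a| <= r%:Z -> `|b| <= r%:Z -> `|p * a + q * b| <= (l * r)%N%:Z.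
    move=> ar br; apply: le_trans (ler_normD _ _) _.
    by rewrite lrE !normrM mulrDl lerD // ler_wpM2l.
  split; rewrite /theta /=.
    rewrite -ht /transverse -mulrN; apply: bnd; first by rewrite /r; lia.
    by rewrite normrN /r; lia.
  exists (parallel p q (h / g)%g); first by apply: bnd; rewrite /r; lia.
  by rewrite exp1rz mulr1 -intrD hp addrC subrK.
case; rewrite /theta /= => tB [k kB].
rewrite exp1rz mulr1 -intrD => /eqP; rewrite eqr_int => /eqP pE.
move: kB; rewrite normr1 expr1n mulr1 => kB.
set g := (f L / f 0%N)%g.
have tg : `|transverse p q g| <= 33 * ((`|p| + `|q|) * r%:Z).
  by rewrite /g tM tV -lrE -PoszM.
have pg : `|parallel p q g| <= 33 * ((`|p| + `|q|) * r%:Z).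
  by rewrite /g pM pV pE -lrE addrC addKr; lia.
have D0 : 0 < p ^+ 2 + q ^+ 2.
  have p2 := sqr_ge0 p; have q2 := sqr_ge0 q.
  rewrite lt_neqAle addr_ge0 // andbT eq_sym paddr_eq0 // !sqrf_eq0.
  by rewrite negb_and.
split; rewrite PoszM.
  apply: (coordinate_bound D0 _ pg (b := - transverse p q g)); first by rewrite normrN.
  by rewrite /transverse /parallel; ring.
apply: (coordinate_bound D0 pg tg).
by rewrite /transverse /parallel; ring.
Qed.

End AbelianCase.

Lemma group_cover (n : int) (rho P : nat) : n != 0%R -> (0 < rho)%N -> (0 < P)%N ->
  exists (rho' : nat) (P' : int) (F : set (BS1 n)), finite_set F /\
  forall N : set (BS1 n), is_normal_subgroup N -> (forall x, N x -> F x -> x = 1%g) ->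
  exists U : 'I_3 -> set (BS1 n),
  [/\ forall x, exists j, U j x,
      forall j x g, N g -> U j x -> U j (x * g)%g
    & forall j (f : nat -> BS1 n) (L : nat),
        (forall i, (i <= L)%N -> U j (f i)) ->
        (forall i, (i < L)%N -> inbox rho P%:Z (f i.+1 / f i)%g) ->
        inbox rho' P' (f L / f 0%N)%g].
Proof.
move=> n_neq0 rho0 P0; have [n1|n1] := eqVneq n 1%R; last exact: group_cover_neq1.
by subst n; exact: group_cover1.
Qed.

(** * A Hex theorem *)

Section Hex.
Variables (c s : nat -> nat -> bool) (X Y : nat).

Hypothesis cs_adj : forall i i' j j', i <= X -> i' <= X -> j <= Y -> j' <= Y ->
  i <= i'.+1 -> i' <= i.+1 -> j <= j'.+1 -> j' <= j.+1 ->
  c i j = c i' j' -> s i j = s i' j'.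
Hypothesis s_left : forall j, j <= Y -> ~~ c 0 j -> s 0 j.
Hypothesis s_right : forall j, j <= Y -> ~~ c X j -> ~~ s X j.
Hypothesis s_bottom : forall i, i <= X -> c i 0 -> s i 0.
Hypothesis s_top : forall i, i <= X -> c i Y -> ~~ s i Y.

(* A door separates a point of colour [false] joined to the left side from one of
   colour [true] joined to the bottom; a unit square has an even number of doors
   while the boundary of the rectangle would have an odd number. *)
Let door i j i' j' := (c i j (+) c i' j') && s i j && s i' j'.
Let row j i := \big[addb/false]_(k < i) door k j k.+1 j.

Lemma cs_adjb i i' j j' : i <= X -> i' <= X -> j <= Y -> j' <= Y ->
  i <= i'.+1 -> i' <= i.+1 -> j <= j'.+1 -> j' <= j.+1 ->
  (c i j == c i' j') ==> (s i j == s i' j').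
Proof. by move=> *; apply/implyP => /eqP e; apply/eqP; apply: cs_adj. Qed.

(** Diagonals count as adjacent, so within a cell [s] is a function of the colour. Either a colour
    is absent or has [s] false, and there are no doors, or the doors are the colour changes around a
    closed circuit. *)
Lemma cell_parity (c1 c2 c3 c4 s1 s2 s3 s4 : bool) :
  (c1 == c2) ==> (s1 == s2) -> (c1 == c3) ==> (s1 == s3) -> (c1 == c4) ==> (s1 == s4) ->
  (c2 == c3) ==> (s2 == s3) -> (c2 == c4) ==> (s2 == s4) -> (c3 == c4) ==> (s3 == s4) ->
  (((c1 (+) c2) && s1 && s2) (+) ((c2 (+) c4) && s2 && s4)) =
  (((c1 (+) c3) && s1 && s3) (+) ((c3 (+) c4) && s3 && s4)).
Proof. by case: c1 c2 c3 c4 s1 s2 s3 s4 => [] [] [] [] [] [] [] []. Qed.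

Lemma door_square i j : i < X -> j < Y ->
  door i j i.+1 j (+) door i.+1 j i.+1 j.+1 = door i j i j.+1 (+) door i j.+1 i.+1 j.+1.
Proof.
move=> iX jY.
by apply: cell_parity; apply: cs_adjb; lia.
Qed.

Lemma rowS j i : row j i.+1 = row j i (+) door i j i.+1 j.
Proof. by rewrite /row big_ord_recr. Qed.

Lemma row_nil j : row j 0 = false.
Proof. by rewrite /row big_ord0. Qed.

Lemma row_parity i j : i <= X -> j < Y ->
  row j i (+) door i j i j.+1 = door 0 j 0 j.+1 (+) row j.+1 i.
Proof.
move=> + jY; elim: i => [|i IH] iX; first by rewrite !row_nil addbF.
rewrite !rowS -addbA door_square //.
by rewrite !addbA (IH (ltnW iX)).
Qed.

(** One end of a door would be a point of colour [false] on the right side and joined to the left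
    one. *)
Lemma door_right j : j < Y -> door X j X j.+1 = false.
Proof.
move=> jY; have /implyP := s_right (ltnW jY); have /implyP := s_right jY; rewrite /door.
by case: (c X j) (c X j.+1) (s X j) (s X j.+1) => [] [] [] [] //=.
Qed.

Lemma row_top i : i <= X -> row Y i = false.
Proof.
elim: i => [|i IH] iX; first by rewrite row_nil.
rewrite rowS (IH (ltnW iX)) /door.
have /implyP := s_top (ltnW iX); have /implyP := s_top iX.
by case: (c i Y) (c i.+1 Y) (s i Y) (s i.+1 Y) => [] [] [] [] //=.
Qed.

(** Bottom points of colour [true] are joined to the bottom, so doors are exactly the changes of
    [s && ~~ c] and the sum telescopes; [left_parity] does the same with [s && c]. *)
Lemma row_bottom i : i <= X -> row 0 i = (s 0 0 && ~~ c 0 0) (+) (s i 0 && ~~ c i 0).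
Proof.
elim: i => [|i IH] iX; first by rewrite row_nil addbb.
rewrite rowS (IH (ltnW iX)) -addbA; congr addb; rewrite /door.
have /implyP := s_bottom (ltnW iX); have /implyP := s_bottom iX.
have := @cs_adjb i i.+1 0 0 (ltnW iX) iX isT isT (leqW (leqnSn i)) (leqnn _) isT isT.
by case: (c i 0) (c i.+1 0) (s i 0) (s i.+1 0) => [] [] [] [] //=.
Qed.

Lemma left_parity j : j <= Y ->
  row 0 X (+) row j X = (s 0 0 && c 0 0) (+) (s 0 j && c 0 j).
Proof.
elim: j => [|j IH] jY; first by rewrite !addbb.
have := row_parity (leqnn X) jY; rewrite door_right // addbF => E.
have -> : row 0 X (+) row j.+1 X = row 0 X (+) row j X (+) door 0 j 0 j.+1.
  by rewrite E; case: (row 0 X) (row j.+1 X) (door 0 j 0 j.+1) => [] [] [].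
rewrite (IH (ltnW jY)) -addbA; congr addb; rewrite /door.
have /implyP := s_left (ltnW jY); have /implyP := s_left jY.
have := @cs_adjb 0 0 j j.+1 isT isT (ltnW jY) jY isT isT (leqW (leqnSn j)) (leqnn _).
by case: (c 0 j) (c 0 j.+1) (s 0 j) (s 0 j.+1) => [] [] [] [] //=.
Qed.

(** The corner (0, 0) is joined to its side whatever its colour. It counts on the bottom for one
    colour and on the left for the other, while the other corners contribute nothing: the boundary
    has an odd number of doors. *)
Lemma hex_contradiction : False.
Proof.
have := left_parity (leqnn Y); rewrite row_top // row_bottom // addbF.
have /implyP := s_left (leq0n Y); have /implyP := s_right (leq0n Y); have /implyP := s_bottom (leq0n X).
have /implyP := s_top (leq0n X).
by case: (c 0 0) (c X 0) (c 0 Y) (s 0 0) (s X 0) (s 0 Y) => [] [] [] [] [] [] //=.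
Qed.

End Hex.

(** * The lower bound *)

Lemma floor_dist (x x' i i' a b c : nat) : x <= i < x + a -> x' <= i' < x' + b ->
  a <= c -> b <= c -> i <= i'.+1 -> i' <= i.+1 -> (`|x'%:Z - x%:Z| <= c%:Z)%R.
Proof. by lia. Qed.

Section LowerBound.
Local Open Scope ring_scope.
Variable R : realType.

Lemma chain_refl (T : Type) (d : T -> T -> R) r (U : set T) x :
  U x -> chain_connected d r U x x.
Proof. by move=> Ux; exists 0%N, (fun=> x). Qed.

Lemma chain_rcons (T : Type) (d : T -> T -> R) r (U : set T) x y z :
  chain_connected d r U x y -> U z -> d y z <= r -> chain_connected d r U x z.
Proof.
move=> [k [c [c0 ck cU cd]]] Uz yz.
exists k.+1, (fun i => if (i <= k)%N then c i else z).
split=> [||i _|i]; rewrite ?leq0n ?ltnn //.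
  by case: ifP => [/cU|].
rewrite ltnS => ik; rewrite ik; have [lt|ge] := ltnP i k; first exact: cd.
have -> : i = k by lia.
by rewrite ck.
Qed.

Lemma no_thin_cover (T : Type) (d : T -> T -> R) (r M : R) (grid : nat -> nat -> T)
    (X Y k : nat) (U : 'I_k.+1 -> set T) :
  (k <= 1)%N -> (\bigcup_j U j = [set: T])%classic ->
  (forall j x y, chain_connected d r (U j) x y -> d x y <= M) ->
  (forall i i' j j', (i <= X)%N -> (i' <= X)%N -> (j <= Y)%N -> (j' <= Y)%N ->
    (i <= i'.+1)%N -> (i' <= i.+1)%N -> (j <= j'.+1)%N -> (j' <= j.+1)%N ->
    d (grid i j) (grid i' j') <= r) ->
  (forall j j', (j <= Y)%N -> (j' <= Y)%N -> M < d (grid 0 j) (grid X j')) ->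
  (forall i i', (i <= X)%N -> (i' <= X)%N -> M < d (grid i 0) (grid i' Y)) ->
  False.
Proof.
move=> k1 Ucov UM dr farX farY.
pose c i j := `[< ~ U ord0 (grid i j) >].
(* For [k = 0] both sets are the whole cover, and the colour [true] does not occur. *)
pose V (b : bool) := if b then U ord_max else U ord0.
have VM b x y : chain_connected d r (V b) x y -> d x y <= M by case: b => /UM.
have Vc i j : V (c i j) (grid i j).
  rewrite /V /c; case: asboolP => [n0|/contrapT //].
  have [j0 _ Uj0] : (\bigcup_j U j)%classic (grid i j) by rewrite Ucov.
  case: (eqVneq j0 ord0) => [e|j00]; first by rewrite e in Uj0.
  suff <- : j0 = ord_max by [].
  by apply: val_inj => /=; move: j00 (ltn_ord j0); rewrite -val_eqE /=; lia.
pose s i j := if c i j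
  then `[< exists2 i0, (i0 <= X)%N & chain_connected d r (V true) (grid i0 0) (grid i j) >]
  else `[< exists2 j0, (j0 <= Y)%N & chain_connected d r (V false) (grid 0 j0) (grid i j) >].
apply: (@hex_contradiction c s X Y).
- move=> i i' j j' iX iX' jY jY' ii' i'i jj' j'j cc.
  have := Vc i j; have := Vc i' j'; rewrite /s -cc; case: (c i j) => Vx Vy.
    apply: asbool_equiv_eq; split=> -[i0 i0X ch]; exists i0 => //.
      by apply: chain_rcons ch _ _ => //; apply: dr.
    by apply: chain_rcons ch _ _ => //; apply: dr.
  apply: asbool_equiv_eq; split=> -[i0 i0X ch]; exists i0 => //.
    by apply: chain_rcons ch _ _ => //; apply: dr.
  by apply: chain_rcons ch _ _ => //; apply: dr.
- move=> j jY c0; have := Vc 0%N j; rewrite /s (negbTE c0) => V0.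
  by apply/asboolP; exists j => //; apply: chain_refl.
- move=> j jY c0; rewrite /s (negbTE c0); apply/asboolP => -[j0 j0Y /VM].
  by rewrite leNgt farX.
- move=> i iX c1; have := Vc i 0%N; rewrite /s c1 => V1.
  by apply/asboolP; exists i => //; apply: chain_refl.
- move=> i iX c1; rewrite /s c1; apply/asboolP => -[i0 i0X /VM].
  by rewrite leNgt farY.
Qed.

(** * Balls against boxes, and the rectangle in a hyperbolic sheet *)

Variables (n : int) (n_neq0 : n != 0).
Local Notation nQ := (n%:~R : rat).
Local Notation G := (BS1 n).
Variables (d : G -> G -> R) (d_proper : proper_right_invariant_metric d).

Lemma metric_ge0 (x y : G) : 0 <= d x y.
Proof.
have [[d0 dC dT] _ _] := d_proper.
have := dT x y x; rewrite (d0 x x).2 // [d y x]dC.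
by rewrite -mulr2n pmulrn_lge0.
Qed.

Lemma metric_div (x y : G) : d x y = d 1%g (y / x)%g.
Proof.
have [_ dR _] := d_proper.
by rewrite -(dR 1%g (y / x)%g x) mul1g mulgVK.
Qed.

Lemma metric_inbox (M : R) : exists (rho : nat) (P : nat), [/\ (0 < rho)%N, (0 < P)%N
  & forall x y, d x y <= M -> inbox rho P%:Z (y / x)%g].
Proof.
have [_ _ dP] := d_proper.
have [rho [P [rho0 P0 sub]]] := finite_sub_inbox n_neq0 (dP 1%g M).
by exists rho, P; split=> // x y; rewrite (metric_div x y) => /sub.
Qed.

Lemma inbox_metric (rho : nat) (P : int) :
  exists2 M : R, 0 < M & forall x y, inbox rho P (y / x)%g -> d x y <= M.
Proof.
have [M M0 MP] := finite_set_bound (d 1%g) (finite_inbox n_neq0 rho P).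
exists M => // x y /MP; rewrite (metric_div x y).
exact: le_trans (ler_norm _).
Qed.

Local Notation q := (absz n).

(** At level [- j], translations of [x] by multiples of [q ^ j] are cheap but smaller integer ones
    need large denominators. Rounding [i] down to such a multiple keeps horizontal neighbours at
    bounded distance. *)
Definition grid (i j : nat) : G := (gen_b n ^- j * gen_a n ^+ (q ^ j * (i %/ q ^ j)))%g.

Lemma tc_grid i j : tc (grid i j) = - j%:Z.
Proof.
rewrite tcM //; have [-> _] := coord_bVX n_neq0 j.
by have [-> _] := coord_aX n_neq0 (q ^ j * (i %/ q ^ j)); rewrite addr0.
Qed.

Lemma xc_grid i j : xc (grid i j) = (q ^ j * (i %/ q ^ j))%N%:R.
Proof.
rewrite xcM //; have [_ ->] := coord_bVX n_neq0 j.
by have [_ ->] := coord_aX n_neq0 (q ^ j * (i %/ q ^ j)); rewrite mulr0 addr0.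
Qed.

Lemma q_gt0 : (0 < q)%N.
Proof. by rewrite absz_gt0. Qed.

Lemma q_sign : exists2 s : int, `|s| = 1 & q%:Z = s * n.
Proof.
exists (Num.sg n); first by rewrite normr_sg n_neq0.
by rewrite abszE normrEsg.
Qed.

Lemma qX_gt0 j : (0 < q ^ j)%N.
Proof. by rewrite expn_gt0 q_gt0. Qed.

Lemma grid_step i i' j j' :
  (i <= i'.+1)%N -> (i' <= i.+1)%N -> (j <= j'.+1)%N -> (j' <= j.+1)%N ->
  inbox 1 (q ^ 2)%N%:Z (grid i' j' / grid i j)%g.
Proof.
move=> ii' i'i jj' j'j; apply/adj_inboxP => //; split; rewrite /= ?tc_grid; first by lia.
have [s s1 qE] := q_sign.
pose x := (q ^ j * (i %/ q ^ j))%N; pose x' := (q ^ j' * (i' %/ q ^ j'))%N.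
have qXE m : (q ^ m)%N%:Z = s ^+ m * n ^+ m by rewrite -exprMn -qE -!natz natrX.
pose u := (i %/ q ^ j)%N%:Z; pose u' := (i' %/ q ^ j')%N%:Z.
(* This is [n * (x' - x) / n ^+ j]; the subtraction is not truncated since [j <= j'.+1], and [s]
   corrects the sign of [n]. *)
pose k : int := n ^+ (j'.+1 - j) * s ^+ j' * u' - n * s ^+ j * u.
have kE : n * (x'%:Z - x%:Z) = k * n ^+ j.
  have e : n ^+ j' * n = n ^+ (j'.+1 - j) * n ^+ j by rewrite -exprSr -exprD subnK.
  rewrite /k /x /x' !PoszM !qXE -/u -/u'.
  transitivity ((n ^+ j' * n) * s ^+ j' * u' - n * s ^+ j * u * n ^+ j); first by ring.
  by rewrite e; ring.
have xi : (x <= i < x + q ^ j)%N.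
  by rewrite /x mulnC leq_divM /= addnC -mulSn -ltn_divLR ?qX_gt0.
have xi' : (x' <= i' < x' + q ^ j')%N.
  by rewrite /x' mulnC leq_divM /= addnC -mulSn -ltn_divLR ?qX_gt0.
have qj : (q ^ j <= q ^ j.+1)%N by rewrite leq_pexp2l ?q_gt0.
have qj' : (q ^ j' <= q ^ j.+1)%N by rewrite leq_pexp2l ?q_gt0.
have xx : `|x'%:Z - x%:Z| <= (q ^ j.+1)%N%:Z by exact: floor_dist xi xi' qj qj' ii' i'i.
exists k.
  have nq : `|n| = q%:Z by rewrite abszE.
  have qj0 : 0 < (q ^ j)%N%:Z by rewrite ltz_nat qX_gt0.
  rewrite -(ler_pM2r qj0).
  have -> : `|k| * (q ^ j)%N%:Z = q%:Z * `|x'%:Z - x%:Z|.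
    by rewrite -nq -normrM kE normrM normrX nq -[in RHS]natz -natrX natz.
  apply: le_trans (ler_wpM2l _ xx) _ => //.
  by rewrite -!PoszM lez_nat -expnS -expnD.
rewrite !xc_grid -/x -/x' opprD opprK nQD // mulrA.
have kEQ : nQ * (x'%:R - x%:R) = k%:~R * nQ ^ j.
  have : (n * (x'%:Z - x%:Z))%:~R = (k * n ^+ j)%:~R :> rat by rewrite kE.
  by rewrite !intrM intrB rmorphXn.
rewrite -kEQ exprN1 mulrAC divff ?nQ_neq0 // mul1r addrC subrK //.
Qed.

Lemma grid_far (M : R) : exists X Y : nat,
  (forall j j', (j <= Y)%N -> (j' <= Y)%N -> M < d (grid 0 j) (grid X j')) /\
  (forall i i', (i <= X)%N -> (i' <= X)%N -> M < d (grid i 0) (grid i' Y)).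
Proof.
have [rho [P [rho0 P0 MP]]] := metric_inbox M.
(* [Y] exceeds the level range of the box. [X] is a multiple of [q ^ Y], hence unaffected by
   rounding at every level, and exceeds [P * q ^ Y], the largest shift a box element allows here. *)
pose Y := rho.+1; pose X := (q ^ Y * (P * q ^ Y).+1)%N.
exists X, Y; split=> [j j' jY jY'|i i' iX iX']; rewrite ltNge; apply/negP => /MP.
  move=> /(adj_inboxP n_neq0)[_ [k kP]]; rewrite /= !xc_grid tc_grid div0n muln0 add0r.
  have -> : (q ^ j' * (X %/ q ^ j') = X)%N.
    by rewrite mulnC divnK // /X dvdn_mulr // dvdn_exp2l.
  rewrite opprD opprK nQD // => E.
  have {}E : X%:Z * n ^+ rho = k * n ^+ j.
    apply: (@intr_inj rat); rewrite !intrM !rmorphXn.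
    have -> : (X%:Z)%:~R = X%:R :> rat by [].
    rewrite E -!mulrA -[nQ ^+ rho]/(nQ ^ rho%:Z) -(nQD n_neq0 (- rho%:Z)).
    by rewrite addNr expr0z mulr1.
  have nq : `|n| = q%:Z by rewrite abszE.
  have : `|X%:Z * n ^+ rho| = `|k * n ^+ j| by rewrite E.
  rewrite !normrM !normrX nq => E'.
  have qr : 1 <= q%:Z ^+ rho by rewrite exprn_ege1 // lez_nat q_gt0.
  have qj : q%:Z ^+ j <= (q ^ Y)%N%:Z.
    by rewrite -[q%:Z]natz -natrX natz lez_nat leq_pexp2l ?q_gt0.
  have : `|X%:Z| <= P%:Z * (q ^ Y)%N%:Z.
    apply: le_trans (_ : `|X%:Z| * q%:Z ^+ rho <= _); first by rewrite ler_peMr.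
    by rewrite E'; apply: ler_pM => //; rewrite exprn_ge0.
  rewrite -PoszM; apply/negP; rewrite -ltNge ger0_norm // ltz_nat /X.
  by rewrite [ltnLHS]mulnC ltn_pmul2l ?qX_gt0 // ltnS leq_pmulr ?qX_gt0.
by move=> /(adj_inboxP n_neq0)[]; rewrite /= !tc_grid /Y; lia.
Qed.

(** The target space is arbitrary so that the identity of the group and a map to a deep quotient are
    both covered. The slack in [M + 1] is for coset distances, which are infima. *)
Lemma lower_bound : exists2 r : R, 0 < r & forall M : R, exists F : set G,
  finite_set F /\ forall (T : Type) (dT : T -> T -> R) (g : G -> T) (k : nat)
    (U : 'I_k.+1 -> set T),
  (forall x y, d x y <= r -> dT (g x) (g y) <= r) ->
  (forall x y, F x -> F y -> dT (g x) (g y) <= M -> d x y <= M + 1) ->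
  (k <= 1)%N -> (\bigcup_j U j = [set: T])%classic ->
  (forall j x y, chain_connected dT r (U j) x y -> dT x y <= M) -> False.
Proof.
have [r r0 rP] := inbox_metric 1 (q ^ 2)%N%:Z.
exists r => // M; have [X [Y [farX farY]]] := grid_far (M + 1).
pose gr (ij : 'I_X.+1 * 'I_Y.+1) := grid ij.1 ij.2.
exists (range gr); split; first exact/finite_image/finite_finset.
move=> T dT g k U gr_le gF k1 Ucov UM.
have inF i j : (i <= X)%N -> (j <= Y)%N -> range gr (grid i j).
  by rewrite -ltnS => iX; rewrite -ltnS => jY; exists (Ordinal iX, Ordinal jY).
apply: (@no_thin_cover T dT r M (fun i j => g (grid i j)) X Y k U k1 Ucov UM).
- by move=> i i' j j' *; apply: gr_le; apply: rP; apply: grid_step.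
- move=> j j' jY jY'; rewrite ltNge; apply/negP => le.
  have := farX j j' jY jY'; rewrite ltNge => /negP; apply.
  by apply: gF => //; apply: inF.
- move=> i i' iX iX'; rewrite ltNge; apply/negP => le.
  have := farY i i' iX iX'; rewrite ltNge => /negP; apply.
  by apply: gF => //; apply: inF.
Qed.

End LowerBound.

(** * Growth and nilpotency *)

Section Growth.
Local Open Scope ring_scope.

Lemma injective_card_le (T : finType) (G : choiceType) (A : set G) (f : T -> G) :
  finite_set A -> injective f -> (forall x, A (f x)) -> (#|T| <= #|` fset_set A|)%N.
Proof.
move=> fA fi fAx; rewrite cardE -(size_map f).
apply: uniq_leq_size; first by rewrite map_inj_uniq // enum_uniq.
by move=> _ /mapP[x _ ->]; rewrite in_fset_set // inE.
Qed.

Section WordBalls.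
Variables (G : groupType) (S : set G).

Lemma word_ball1 k : word_ball S k 1%g.
Proof. by exists [::]; rewrite big_nil. Qed.

Lemma word_ballM k m x y : word_ball S k x -> word_ball S m y ->
  word_ball S (k + m) (x * y)%g.
Proof.
move=> [s [sk sS ->]] [t [tm tS ->]]; exists (s ++ t); split.
- by rewrite size_cat leq_add.
- by move=> z; rewrite mem_cat => /orP[/sS|/tS].
- by rewrite big_cat.
Qed.

Lemma word_ball_le k m x : (k <= m)%N -> word_ball S k x -> word_ball S m x.
Proof. by move=> km [s [sk sS ->]]; exists s; split=> //; apply: leq_trans km. Qed.

Lemma word_ball_gen x : S x -> word_ball S 1 x /\ word_ball S 1 (x^-1)%g.
Proof.
move=> Sx; split; [exists [:: x] | exists [:: (x^-1)%g]]; split=> //;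
  rewrite ?big_seq1 // => y; rewrite inE => /eqP ->; [by left|].
by right; rewrite invgK.
Qed.

Lemma word_ball_finite k : finite_set S -> finite_set (word_ball S k).
Proof.
move=> fS; elim: k => [|k IH].
  apply: (@sub_finite_set _ _ [set 1%g]%classic) => [x [[|y s] [//= _ _ ->]]|].
    by rewrite big_nil.
  exact: finite_set1.
pose S' := (S `|` (fun x => x^-1)%g @` S)%classic.
have fS' : finite_set S' by rewrite finite_setU; split=> //; exact: finite_image.
apply: (@sub_finite_set _ _ (word_ball S k `|`
    (fun z => z.1 * z.2)%g @` (S' `*` word_ball S k))%classic).
  move=> x [[|y s] [sk sS ->]]; first by left; rewrite big_nil; exact: word_ball1.
  right; exists (y, \prod_(z <- s) z)%g; last by rewrite big_cons.
  split=> /=.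
    have [Sy|Sy] := sS y (mem_head _ _); first by left.
    by right; exists (y^-1)%g => //; rewrite invgK.
  by exists s; split=> // z zs; apply: sS; rewrite inE zs orbT.
rewrite finite_setU; split=> //; apply: finite_image; exact: finite_setX.
Qed.

End WordBalls.

(** A convex function lies below its chord on [0, 1]. This produces a base above 1 whose [m]-th
    power is at most 2 without extracting roots. *)
Lemma expr1D_le (R : realType) (x : R) (m : nat) : 0 <= x <= 1 ->
  (1 + x) ^+ m <= 1 + (2 ^+ m - 1) * x.
Proof.
move=> /andP[x0 x1]; elim: m => [|m IH]; first by rewrite !expr0 subrr mul0r addr0.
have p1 : 1 <= 2 ^+ m :> R by rewrite exprn_ege1 // ler1n.
rewrite exprS [2 ^+ m.+1]exprS; apply: le_trans (_ : (1 + x) * (1 + (2 ^+ m - 1) * x) <= _).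
  by rewrite ler_wpM2l // addr_ge0.
have : (2 ^+ m - 1) * (x * x) <= (2 ^+ m - 1) * x.
  by rewrite ler_wpM2l ?subr_ge0 // -[leRHS]mulr1 ler_wpM2l.
by move: (2 ^+ m) => u; lra.
Qed.

Variables (n : int) (n_ge3 : 3 <= n).
Local Notation nQ := (n%:~R : rat).
Local Notation G := (BS1 n).

Let n_neq0 : n != 0. Proof. by apply/eqP; lia. Qed.

(** The [x] coordinate reads the bits as digits in base [n], the head of the list being the units
    digit. *)
Fixpoint binary_word (s : seq bool) : G :=
  if s is e :: s' then (binary_word s' * (gen_b n * gen_a n ^+ nat_of_bool e))%g else 1%g.

Lemma xc_binary_word e s :
  xc (binary_word (e :: s)) = e%:R + xc (binary_word s) / nQ.
Proof.
rewrite /= !xcM // tcM // tc_b // xc_b //.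
have [-> ->] := coord_aX n_neq0 e.
by rewrite mulr0 !addr0 exprN1 mulrC.
Qed.

Lemma xc_binary_word_bound s : 0 <= xc (binary_word s) <= 3 / 2.
Proof.
elim: s => [|e s /andP[IH0 IH1]]; first by rewrite /= xc1.
have n3 : 3 <= nQ by rewrite -[3]/(3%:~R) ler_int.
have h : xc (binary_word s) / nQ <= 1 / 2.
  by rewrite ler_pdivrMr ?(lt_le_trans _ n3) //; lra.
have h0 : 0 <= xc (binary_word s) / nQ by rewrite divr_ge0 // (le_trans _ n3).
by rewrite xc_binary_word; apply/andP; case: e; rewrite /= ?mulr1n ?mulr0n; split; lra.
Qed.

(** All digits after the first contribute between 0 and 1/2, so [x] determines the first digit. *)
Lemma binary_word_inj s t : size s = size t -> binary_word s = binary_word t -> s = t.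
Proof.
suff main : size s = size t -> xc (binary_word s) = xc (binary_word t) -> s = t.
  by move=> st e; apply: main; rewrite ?e.
elim: s t => [|e s IH] [|e' t] //= [st]; rewrite -!/(binary_word (_ :: _)) !xc_binary_word => E.
have n3 : 3 <= nQ by rewrite -[3]/(3%:~R) ler_int.
have b u : 0 <= xc (binary_word u) / nQ <= 1 / 2.
  have /andP[b0 b1] := xc_binary_word_bound u; apply/andP; split.
    by rewrite divr_ge0 // (le_trans _ n3).
  by rewrite ler_pdivrMr ?(lt_le_trans _ n3) //; lra.
have ee : e = e'.
  have /andP[] := b s; have /andP[] := b t; move: E.
  by case: e e' {IH} => [] [] //; rewrite /= ?mulr1n ?mulr0n; lra.
move: E; rewrite ee => /addrI /(mulIf _); rewrite invr_neq0 ?nQ_neq0 // => /(_ isT) E.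
by rewrite (IH t st E).
Qed.

Lemma BS1_generated : exists S : set G, finite_generating_set S.
Proof.
exists [set gen_a n; gen_b n]%classic; split; first exact: finite_set2.
apply/seteqP; split=> // g _.
rewrite -[g]pres_reprK; elim: (repr g) => [|l w [k _ IH]].
  by exists 0%N => //; exact: word_ball1.
exists (1 + k)%N => //; rewrite class_cons; apply: word_ballM IH.
have [a1 a2] : word_ball [set gen_a n; gen_b n]%classic 1 (gen_a n) /\ _ :=
  word_ball_gen (or_introl erefl).
have [b1 b2] : word_ball [set gen_a n; gen_b n]%classic 1 (gen_b n) /\ _ :=
  word_ball_gen (or_intror erefl).
by case: l => [[] []]; rewrite -?class_a_inv -?class_b_inv in a2 b2 *.
Qed.

Lemma BS1_exponential_growth (R : realType) : exponential_growth R G.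
Proof.
split=> [|S [fS gS]]; first exact: BS1_generated.
have ball g : exists k, word_ball S k g.
  by have [k _ kg] : (\bigcup_k word_ball S k)%classic g by [rewrite gS]; exists k.
have [k0 h0] := ball (gen_b n * gen_a n ^+ 0)%g; have [k1 h1] := ball (gen_b n * gen_a n ^+ 1)%g.
pose L := (k0 + k1).+1.
have wball s : word_ball S (L * size s) (binary_word s).
  elim: s => [|e s IH]; first exact: word_ball1.
  rewrite /= mulnS addnC; apply: word_ballM IH _.
  by case: e; [apply: word_ball_le h1 | apply: word_ball_le h0]; rewrite /L; lia.
(* For [L <= k], the ball of radius [k] contains [2 ^ (k %/ L)] binary words and
   [k <= m * (k %/ L)], so [c ^+ m <= 2] is what is required of [c]. *)
pose m := (2 * L)%N.
pose c : R := 1 + (2 ^+ m)^-1.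
have p0 : 0 < 2 ^+ m :> R by rewrite exprn_gt0.
have c1 : 1 < c by rewrite /c ltrDl invr_gt0.
have cm : c ^+ m <= 2.
  have pinv : 0 <= (2 ^+ m : R)^-1 <= 1.
    by rewrite invr_ge0 ltW //= invf_le1 // exprn_ege1 // ler1n.
  apply: le_trans (expr1D_le m pinv) _.
  by rewrite mulrBl mulfV ?gt_eqF // mul1r; lra.
have fball k : finite_set (word_ball S k) by exact: word_ball_finite.
have dbl e k : (0 < e)%N -> (2 ^ e <= #|` fset_set (word_ball S k)|)%N -> (k <= m * e)%N ->
    c ^+ k <= (#|` fset_set (word_ball S k)|)%:R.
  move=> e0 card kme; apply: le_trans (_ : (2 ^ e)%:R <= _); last by rewrite ler_nat.
  apply: le_trans (ler_weXn2l (ltW c1) kme) _; rewrite exprM natrX.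
  by apply: lerXn2r; rewrite ?nnegrE // exprn_ge0 // ltW // (lt_trans _ c1).
exists c; split=> // k; have [->|k_gt0] := posnP k.
  rewrite expr0 ler1n.
  rewrite cardfs_gt0; apply/fset0Pn; exists 1%g.
  by rewrite in_fset_set // inE; exact: word_ball1.
(* For radii from 1 to [L - 1] two elements suffice: the identity and a non-trivial generator. *)
have [kL|Lk] := ltnP k L.
  apply: (dbl 1%N) => //; last by rewrite /m; lia.
  have [y Sy y1] : exists2 y, S y & y <> 1%g.
    apply: contrapT => nS.
    have Striv y : S y -> y = 1%g by move=> Sy; apply: contrapT => y1; apply: nS; exists y.
    have [j [s [_ sS sE]]] := ball (gen_b n).
    have : gen_b n = 1%g.
      rewrite sE big1_seq // => z /= zs; case: (sS z zs) => /Striv //.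
      by move=> e; rewrite -[z]invgK e invg1.
    by move=> e; have := tc_b n_neq0; rewrite e tc1.
  rewrite -[(2 ^ 1)%N]card_bool.
  apply: (@injective_card_le bool _ _ (fun b => if b then y else 1%g)) => //.
    by case=> [] [] // e; case: y1.
  case; last exact: word_ball1.
  by apply: word_ball_le k_gt0 _; case: (word_ball_gen Sy).
apply: (dbl (k %/ L)%N); first by rewrite divn_gt0.
  have -> : (2 ^ (k %/ L))%N = #|{: (k %/ L).-tuple bool}| by rewrite card_tuple card_bool.
  apply: (@injective_card_le _ _ _ (fun t : (k %/ L).-tuple bool => binary_word t)) => //.
    by move=> s t /binary_word_inj e; apply: val_inj; apply: e; rewrite !size_tuple.
  move=> t; apply: word_ball_le (wball t); rewrite size_tuple mulnC; exact: leq_divM.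
have := divn_eq k L; have := ltn_pmod k (_ : 0 < L)%N.
by move=> /(_ isT); have : (0 < k %/ L)%N by [rewrite divn_gt0]; rewrite /m; nia.
Qed.

Lemma finite_index_expg (H : set G) (x : G) : is_subgroup H -> finite_index H ->
  exists2 k, (0 < k)%N & H (x ^+ k)%g.
Proof.
move=> sH fH; apply: contrapT => nk.
pose f (i : nat) := left_coset H (x ^+ i)%g.
have lt_neq i j : (i < j)%N -> f i = f j -> False.
  move=> ij e; apply: nk; exists (j - i)%N; first by rewrite subn_gt0.
  have : f j (x ^+ j)%g by exists 1%g; [exact: sH.1 | rewrite mulg1].
  rewrite -e => -[h Hh hE].
  have -> // : (x ^+ (j - i) = h)%g.
  apply: (mulgI (x ^+ i)%g); rewrite hE -expgnDr; congr (_ ^+ _)%g; lia.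
have fi : injective f.
  by move=> i j e; case: (ltngtP i j) => // /lt_neq; [move/(_ e) | move/(_ (esym e))].
have : finite_set (f @^-1` cosets H)%classic.
  by apply: finite_preimage fH => i j _ _; exact: fi.
have -> : (f @^-1` cosets H = [set: nat])%classic.
  by apply/seteqP; split=> // i _; exists (x ^+ i)%g.
exact: infinite_nat.
Qed.

(** Finite index puts powers of [a] and [b] in [H]. Commutation with [b ^+ j] multiplies a
    translation by [n ^ (- j) - 1], which is non-zero, so every term of the series contains a
    non-trivial translation. *)
Lemma BS1_not_virtually_nilpotent : ~ virtually_nilpotent G.
Proof.
move=> [H [sH fH [k nilH]]].
have [i i0 Ha] := finite_index_expg (gen_a n) sH fH.
have [j j0 Hb] := finite_index_expg (gen_b n) sH fH.
have main m : exists g, [/\ lower_central_series H m g, tc g = 0 & xc g != 0].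
  elim: m => [|m [g [gm tg xg]]].
    exists (gen_a n ^+ i)%g; have [ti xi] := coord_aX n_neq0 i; split=> //.
    by rewrite xi pnatr_eq0 -lt0n.
  exists [~ g, gen_b n ^+ j]%g; split.
  - by move=> K [sK]; apply; exists g, (gen_b n ^+ j)%g.
  - have [tj xj] := coord_bX n_neq0 j.
    by rewrite commgEl conjgE !tcM // !tcV // tg; lia.
  have [tj xj] := coord_bX n_neq0 j.
  rewrite commgEl conjgE !xcM // !tcM // !tcV // !xcV // tg tj xj.
  rewrite !(mulr0, oppr0, addr0, add0r, opprK, expr0z, mul1r, subrr, addNr).
  have -> : nQ ^ (- j%:Z) * xc g - xc g = (nQ ^ (- j%:Z) - 1) * xc g by ring.
  rewrite mulf_neq0 // subr_eq0; apply/eqP => /exprz_eq1.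
  rewrite oppr_eq0 => /(_ _) h; have : `|n| = 1 by apply: h; lia.
  by move: n_ge3; lia.
have [g [gk tg /eqP xg]] := main k.
by apply: xg; move: gk; rewrite nilH => ->; exact: xc1.
Qed.

End Growth.

(** * Box spaces *)

Section BoxSpace.
Local Open Scope ring_scope.
Variables (R : realType) (n : int) (n_neq0 : n != 0).
Local Notation G := (BS1 n).
Variables (d : G -> G -> R) (d_proper : proper_right_invariant_metric d).

Lemma asdim_eq2 (T : Type) (dT : T -> T -> R) :
  asdim_le dT 2 -> (forall k, (k <= 1)%N -> ~ asdim_le dT k) -> asdim dT = 2%:E.
Proof.
move=> le2 nle1; apply/eqP; rewrite eq_le; apply/andP; split.
  by apply: ereal_inf_lbound; exists 2%N.
apply: le_ereal_inf_tmp => _ [k kle <-]; rewrite lee_fin ler_nat ltnNge.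
by apply/negP => k1; apply: nle1 kle.
Qed.

(** [M] and [F] are chosen before N; this uniformity is what the box space needs. *)
Lemma cover_metric (r : R) : exists2 M : R, 0 < M & exists2 F : set G, finite_set F &
  forall N : set G, is_normal_subgroup N -> (forall x, N x -> F x -> x = 1%g) ->
  exists U : 'I_3 -> set G,
  [/\ forall x, exists j, U j x,
      forall j x g, N g -> U j x -> U j (x * g)%g
    & forall j x y, chain_connected d r (U j) x y -> d x y <= M].
Proof.
have [rho [P [rho0 P0 rP]]] := metric_inbox n_neq0 d_proper r.
have [rho' [P' [F [fF FN]]]] := group_cover n_neq0 rho0 P0.
have [M M0 MP] := inbox_metric n_neq0 d_proper rho' P'.
exists M => //; exists F => // N nN NF; have [U [Uc Ui Uf]] := FN N nN NF.
exists U; split=> // j x y [k [c [<- <- cU cd]]].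
by apply: MP; apply: (Uf j) => // i /cd; exact: rP.
Qed.

Lemma group_asdim : asdim d = 2%:E.
Proof.
apply: asdim_eq2 => [r r0|k k1 dk].
  have [M M0 [F fF FN]] := cover_metric r; exists M; split=> //.
  have [||U [Uc _ UM]] := FN [set 1%g]%classic.
  - split; first by split=> // _ _ -> ->; rewrite /= mulgV.
    by move=> _ y ->; rewrite /= conj1g.
  - by move=> x ->.
  exists U; split=> //; apply/seteqP; split=> // x _.
  by have [j Ujx] := Uc x; exists j.
have [r r0 low] := lower_bound n_neq0 d_proper.
have [M [M0 [U [Uc UM]]]] := dk r r0.
have [F [_ FM]] := low M.
apply: (FM G d id k U) => // x y _ _ /le_trans; apply.
by rewrite lerDl.
Qed.

(** * Distances between cosets *)

Section Cosets.
Variables (H : set G) (sH : is_subgroup H).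

Lemma coset_nonempty (A : cosets H) : exists x, val A x.
Proof.
have /set_mem[x _ <-] := valP A; exists x, 1%g; first exact: sH.1.
by rewrite mulg1.
Qed.

Lemma coset_mulr (A : cosets H) x g : H g -> val A x -> val A (x * g)%g.
Proof.
have /set_mem[y _ <-] := valP A => Hg [h Hh <-]; exists (h * g)%g.
  exact: subgroupM.
by rewrite mulgA.
Qed.

Lemma coset_div (A : cosets H) x y : val A x -> val A y -> H (x^-1 * y)%g.
Proof.
have /set_mem[z _ <-] := valP A => -[h Hh <-] [h' Hh' <-].
rewrite invgM -mulgA mulKg; apply: subgroupM => //; exact: subgroupV.
Qed.

Definition coset_of_elt (x : G) : cosets H :=
  exist _ (left_coset H x) (mem_set (ex_intro2 _ _ x I erefl)).

Lemma set_dist_le (A B : set G) x y : A x -> B y -> set_dist d A B <= d x y.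
Proof.
move=> Ax By; apply: ge_inf; last by exists x, y.
by exists 0 => _ [u [v [_ _ ->]]]; exact: metric_ge0.
Qed.

(** Right multiplication by [H] is isometric and preserves each left coset, so a pair nearly
    realising the infimum can be moved to start at the given [x]. *)
Lemma set_dist_lt (A B : cosets H) (r : R) x : set_dist d (val A) (val B) < r ->
  val A x -> exists2 y, val B y & d x y < r.
Proof.
have [x0 Ax0] := coset_nonempty A; have [y0 By0] := coset_nonempty B.
move=> /inf_lt[|_ [u [v [Au Bv ->]]] uv Ax]; first by exists (d x0 y0), x0, y0.
exists (v * (u^-1 * x))%g; first by apply: coset_mulr => //; apply: coset_div Au Ax.
have [_ dR _] := d_proper.
by rewrite -{1}[x](mulVKg u) dR.
Qed.

Lemma set_dist_bounded : finite_index H ->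
  exists2 M : R, 0 < M & forall A B : cosets H, set_dist d (val A) (val B) <= M.
Proof.
move=> fH.
have [M M0 MP] := finite_set_bound (fun z : set G * set G => set_dist d z.1 z.2)
  (finite_setX fH fH).
exists M => // A B; apply: le_trans (ler_norm _) (MP (val A, val B) _).
by split; apply/set_mem; exact: valP.
Qed.

Lemma set_dist_diameter (A B : cosets H) : finite_index H ->
  set_dist d (val A) (val B) <= diameter (coset_dist d (H := H)).
Proof.
move=> /set_dist_bounded[M _ MP]; apply: ub_le_sup; last by exists A, B.
by exists M => _ [u [v ->]]; exact: MP.
Qed.

Lemma diameter_ge0 : finite_index H -> 0 <= diameter (coset_dist d (H := H)).
Proof.
move=> fH; apply: le_trans (set_dist_diameter (coset_of_elt 1%g) (coset_of_elt 1%g) fH).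
apply: lb_le_inf => [|_ [u [v [_ _ ->]]]]; last exact: metric_ge0.
have [x Ax] := coset_nonempty (coset_of_elt 1%g).
by exists (d x x), x, x.
Qed.

End Cosets.

(** * Filtrations and the box space *)

Variable N : nat -> set G.
Hypotheses (N_normal : forall i, is_normal_subgroup (N i))
  (N_decr : forall i, (N i.+1 `<=` N i)%classic) (N_filt : is_filtration N).

Lemma N_antitone i j : (i <= j)%N -> (N j `<=` N i)%classic.
Proof.
move=> ij; rewrite -(subnK ij); elim: (j - i)%N => [|k IH] //.
by rewrite addSn => x /N_decr /IH.
Qed.

Lemma eventually_trivial (F : set G) : finite_set F ->
  exists i0, forall i, (i0 <= i)%N -> forall x, N i x -> F x -> x = 1%g.
Proof.
move=> /finite_seqP[s ->]; elim: s => [|y s [i0 IH]]; first by exists 0%N.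
have [i1 yi1] : exists i1, N i1 y -> y = 1%g.
  have [Ny|nNy] := pselect ((\bigcap_i N i)%classic y).
    by exists 0%N => _; move: Ny; rewrite N_filt.2.
  apply: contrapT => h; apply: nNy => i _; apply: contrapT => nNi; apply: h.
  by exists i.
exists (maxn i0 i1) => i; rewrite geq_max => /andP[h0 h1] x Nx.
rewrite /= inE => /orP[/eqP e|xs]; last exact: IH i h0 x Nx xs.
by move: Nx; rewrite e => /(N_antitone h1).
Qed.

Local Notation bd := (box_dist d (N := N)).
Local Notation diam i := (diameter (coset_dist d (H := N i))).

Let sN i : is_subgroup (N i) := (N_normal i).1.
Let fN i : finite_index (N i) := (N_filt.1 i).2.

Lemma box_dist_same (p q : box_space N) : tag p = tag q ->
  bd p q = set_dist d (val (tagged p)) (val (tagged q)).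
Proof. by rewrite /box_dist => /eqP ->. Qed.

Lemma box_dist_neq (p q : box_space N) : tag p <> tag q ->
  bd p q = diam (tag p) + diam (tag q).
Proof. by rewrite /box_dist => /eqP/negbTE ->. Qed.

Lemma box_dist_diameter (p q : box_space N) : tag p = tag q -> bd p q <= diam (tag p).
Proof.
case: p q => [i A] [j B] /= e; subst j.
by rewrite box_dist_same //=; exact: set_dist_diameter.
Qed.

Lemma box_asdim_le2 : asdim_le bd 2.
Proof.
move=> r r0.
(* Lifted steps are only known to be shorter than [r + 1], because the infimum defining a coset
   distance is approached with a margin. *)
have [M M0 [F fF FN]] := cover_metric (r + 1).
have [i0 trivF] := eventually_trivial fF.
have step i : exists U : 'I_3 -> set G, (i0 <= i)%N ->
    [/\ forall x, exists j, U j x,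
      forall j x g, N i g -> U j x -> U j (x * g)%g
    & forall j x y, chain_connected d (r + 1) (U j) x y -> d x y <= M].
  have [ii|_] := boolP (i0 <= i)%N; last by exists (fun=> set0).
  by have [U UP] := FN (N i) (N_normal i) (trivF i ii); exists U.
have [W WP] := choice step.
have [D D0 DP] := finite_set_bound (fun i => diam i) (finite_II i0).
exists (M + D + (r + r)); split; first by rewrite !addr_gt0.
(* The finitely many quotients before [i0] go whole into each of the three sets; [D] bounds their
   diameters. *)
pose V (j : 'I_3) (p : box_space N) := (tag p < i0)%N \/
  exists2 x, val (tagged p) x & W (tag p) j x.
exists V; split.
  apply/seteqP; split=> // p _; have [lt|ge] := ltnP (tag p) i0.
    by exists ord0 => //; left.
  have [Wc _ _] := WP _ ge; have [x px] := coset_nonempty (sN _) (tagged p).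
  by have [j Wx] := Wc x; exists j => //; right; exists x.
move=> j p q [k [c [c0 ck cV cd]]].
have diam0 i : 0 <= diam i by exact: diameter_ge0.
(* A jump between quotients costs the sum of their diameters, so a chain that leaves its first
   quotient only visits quotients of diameter at most [r]. *)
have main m : (m <= k)%N -> (forall l, (l <= m)%N -> tag (c l) = tag p) \/
    (diam (tag p) <= r /\ diam (tag (c m)) <= r).
  elim: m => [|m IH] mk.
    by left=> l; rewrite leqn0 => /eqP ->; rewrite c0.
  have [e|ne] := eqVneq (tag (c m)) (tag (c m.+1)).
    have [same|[dp dm]] := IH (ltnW mk); last by right; rewrite -e.
    left=> l; rewrite leq_eqVlt => /orP[/eqP ->|]; last exact: same.
    by rewrite -e same.
  have := cd m mk; rewrite box_dist_neq; last exact/eqP.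
  have := diam0 (tag (c m)); have := diam0 (tag (c m.+1)) => d1 d2 dr.
  right; have [same|[dp dm]] := IH (ltnW mk).
    by rewrite -(same m (leqnn m)); split; lra.
  by split=> //; lra.
have M0' := ltW M0; have D0' := ltW D0.
have [same|[dp dq]] := main k (leqnn k); last first.
  rewrite ck in dq; have [e|ne] := eqVneq (tag p) (tag q).
    by have := box_dist_diameter e; lra.
  by rewrite box_dist_neq; [lra | exact/eqP].
have pq : tag p = tag q by rewrite -ck same.
have [lt|ge] := ltnP (tag p) i0.
  have := box_dist_diameter pq; have := DP _ lt; rewrite ger0_norm //; lra.
have [_ Wi WM] := WP _ ge.
(* Invariance of [W] passes membership from one representative to all, so the lifted chain may use
   whichever one is close. *)
have inW m x : (m <= k)%N -> val (tagged (c m)) x -> W (tag p) j x.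
  move=> mk cx; have tm := same m mk.
  have [lt|[y cy Wy]] := cV m mk; first by move: lt; rewrite tm ltnNge ge.
  rewrite tm in Wy; have := coset_div (sN _) cy cx; rewrite tm => Nyx.
  by have -> : (x = y * (y^-1 * x))%g by [rewrite mulVKg]; exact: Wi.
have [x0 px0] := coset_nonempty (sN _) (tagged (c 0%N)).
have lift m : (m <= k)%N -> exists2 x, val (tagged (c m)) x &
    chain_connected d (r + 1) (W (tag p) j) x0 x.
  elim: m => [|m IH] mk; first by exists x0 => //; apply: chain_refl; exact: inW px0.
  have [x cx ch] := IH (ltnW mk).
  have tagE : tag (c m.+1) = tag (c m) by rewrite !same // ltnW.
  have := cd m mk; rewrite box_dist_same // => dr.
  have next (p' : box_space N) : tag p' = tag (c m) ->
      set_dist d (val (tagged (c m))) (val (tagged p')) < r + 1 ->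
      exists2 y, val (tagged p') y & d x y < r + 1.
    case: p' => i B /= e; subst i => lt.
    exact: (@set_dist_lt _ (sN (tag (c m))) (tagged (c m)) B _ x lt cx).
  have [|y cy xy] := next _ tagE; first by rewrite (le_lt_trans dr) // ltrDl.
  by exists y => //; apply: chain_rcons ch _ (ltW xy); exact: inW cy.
have [x cx ch] := lift k (leqnn k).
rewrite box_dist_same //.
have : set_dist d (val (tagged p)) (val (tagged q)) <= d x0 x.
  by apply: set_dist_le; [rewrite -c0 | rewrite -ck].
by have := WM _ _ _ ch; lra.
Qed.

Lemma box_asdim_ge2 k : (k <= 1)%N -> ~ asdim_le bd k.
Proof.
move=> k1 dk.
have [r r0 low] := lower_bound n_neq0 d_proper.
have [M [M0 [U [Uc UM]]]] := dk r r0.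
have [F [fF FM]] := low M.
have [dm dR dfin] := d_proper.
(* If [z] lies in the coset of [y] and is within [M + 1] of [x], then [y^-1 * z] is
   [y^-1 * (z / x) * x], an element of N in this finite set; at a deep index it is trivial and
   [z = y]. *)
pose shift (z : (G * G) * G) := (z.1.1^-1 * (z.1.2 * z.2))%g.
have [i0 triv] : exists i0, forall i, (i0 <= i)%N -> forall x, N i x ->
    (shift @` ((F `*` [set f | d 1%g f <= M + 1]) `*` F))%classic x -> x = 1%g.
  apply: eventually_trivial; apply: finite_image.
  by apply: finite_setX => //; apply: finite_setX => //; exact: dfin.
pose g (x : G) : box_space N := Tagged (fun i => cosets (N i)) (coset_of_elt (N i0) x).
have gx x : val (tagged (g x)) x by exists 1%g; [exact: (sN i0).1 | rewrite mulg1].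
apply: (FM (box_space N) bd g k U) => // x y.
  by move=> dxy; rewrite box_dist_same //; apply: le_trans dxy; apply: set_dist_le.
move=> Fx Fy; rewrite box_dist_same // => le.
have lt : set_dist d (val (tagged (g x))) (val (tagged (g y))) < M + 1.
  by rewrite (le_lt_trans le) // ltrDl.
have [z gz xz] := set_dist_lt (sN i0) lt (gx x).
have e : (y^-1 * z = 1)%g.
  apply: (triv i0 (leqnn _)); first exact: coset_div (gx y) gz.
  exists (y, (z / x)%g, x); last by rewrite /shift /= mulgVK.
  by split=> //; split=> //; rewrite /= -metric_div // ltW.
by rewrite -(mulg1_eq e) invgK in xz; apply: ltW.
Qed.

Lemma box_asdim : asdim bd = asdim d.
Proof.
by rewrite group_asdim; apply: asdim_eq2; [exact: box_asdim_le2 | exact: box_asdim_ge2].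
Qed.

End BoxSpace.

Theorem corollary7p5 (R : realType) (n : int) (n_neq0 : n != 0%R) :
  ((3 <= n)%R ->
     exponential_growth R (BS1 n) /\ ~ virtually_nilpotent (BS1 n)) /\
  forall d : BS1 n -> BS1 n -> R, proper_right_invariant_metric d ->
    asdim d = 2%:E%R /\
    forall N : nat -> set (BS1 n),
      (forall i, is_normal_subgroup (N i)) ->
      (forall i, (N i.+1 `<=` N i)%classic) ->
      is_filtration N ->
      asdim (box_dist d (N := N)) = asdim d.
Proof.
split=> [n3|d d_proper].
  by split; [exact: BS1_exponential_growth | exact: BS1_not_virtually_nilpotent].
split; first exact: group_asdim.
by move=> N N_normal N_decr N_filt; exact: box_asdim.
Qed.
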